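(* There exist constants $\delta>0$ and $c_\delta>0$ such that, with $\tilde\delta=c_\delta\delta^2$, the following holds. Assume Assumption 1 (parts (i), (ii), (iii) as given in the context). Let $\nu\in(0,1)$, $\alpha\in(0,\frac{1-\nu}{2})$, $\beta\in(0,1)$, $c_b>0$, $0<\tau\le \sqrt{\tilde\delta}/L_F$ be constants independent of $T$, put $$\bar L_F=2L_F+\frac{\tau L_F^2}{\delta}+3\delta\tau L_F^2,\qquad \eta=\frac{(1-2\alpha-\nu)/2}{\frac{\bar L_F}{L_F}+\frac{(1+\nu)\beta^2}{(1-\alpha)\alpha}},$$ and let $\{(x^k,B^k,\Lambda^k)\}$ be generated by DualHash-StoM with $$\eta_k=\frac{\eta}{L_F},\quad \alpha_k=\alpha,\quad \beta_k=\beta,\quad b_k=b=c_bT\qquad(k\ge1).$$ Then there are positive constants $L_\Delta$, $C_\sigma$, independent of $T$ and depending only on $(L_F,\eta,\alpha,\beta,\tau,\delta,\nu)$, such that for every $\varepsilon>0$, if $T$ satisfies $$T=\left\lceil\frac{L_\Delta\Delta_1+C_\sigma\frac{\sigma^2}{c_b}}{\varepsilon^2}\right\rceil ,$$ where $\Delta_1=\mathbb E[\Psi^1_{\rm sgdm}]-\Psi^*_{\rm sgdm}$, then for $R$ selected uniformly from $\{2,\dots,T+1\}$, $$\mathbb E\big[\mathrm{dist}^2(0,\partial\mathcal L(x^R,B^R,\Lambda^R))\big]\le\varepsilon^2 .$$ Moreover, the total number of stochastic first-order oracle (SFO) calls is of order $\mathcal O(\varepsilon^{-4})$.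
   Context: Setting. $\mathcal X$ is a finite-dimensional real Hilbert space; $\mathcal B=\mathcal Y=\mathcal Y^*=\mathbb R^{n\times d}$ with Frobenius inner product and norm; $B=[b_1,\dots,b_n]$ with $b_i\in\mathbb R^d$. $f_i:\mathcal X\to\mathbb R$ and $D_i:\mathcal X\to\mathbb R^d$ ($i=1,\dots,n$) are continuously differentiable, $\gamma>0$, $F_i(x,b_i)=f_i(x)+\frac{\gamma}{2}\|D_i(x)-b_i\|^2$ and $F(x,B)=\frac1n\sum_{i=1}^nF_i(x,b_i)$. $h:\mathbb R^d\to(-\infty,+\infty]$ is a lower semicontinuous proper function (proper: nonempty domain and $\inf h>-\infty$), a W-type regularizer, the model case being $h(z)=\lambda\sum_j||z_j|-1|$ with $\lambda>0$; $h(B)=\sum_ih(b_i)$; $J(x,B)=F(x,B)+h(B)$. $h^*(\Lambda)=\sup_{Y}\{\langle\Lambda,Y\rangle-h(Y)\}$ is the conjugate. The Lagrangian is $\mathcal L(x,B,\Lambda)=F(x,B)+\langle B,\Lambda\rangle-h^*(\Lambda)$, and $\partial\mathcal L(x,B,\Lambda)=\{\nabla_xF(x,B)\}\times\{\nabla_BF(x,B)+\Lambda\}\times(B-\partial h^*(\Lambda))$. $\mathrm{dist}$ is Euclidean distance to a set. Assumption 1. (i) The generated sequence $\{(x^k,B^k,\Lambda^k)\}$ is bounded and $J$ is bounded below by $J^*$. (ii) $F$ is $L_F$-smooth in $(x,B)$ (gradient $L_F$-Lipschitz), $L_F=\mathcal O(1)$ (independent of $n$). (iii) For $i$ uniform on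 $\{1,\dots,n\}$ and any $B$, $\mathbb E_i[\nabla_xF_i(x,b_i)]=\nabla_xF(x,B)$ and $\mathbb E_i\|\nabla_xF_i(x,b_i)-\nabla_xF(x,B)\|^2\le\sigma^2$. DualHash-StoM. At iteration $k\ge1$ a mini-batch $\mathcal J_k\subseteq\{1,\dots,n\}$ of size $b_k$ is sampled uniformly (afresh), $\nabla_xF(x,B;\mathcal J_k)=\frac1{b_k}\sum_{j\in\mathcal J_k}\nabla_xF_j(x,b_j)$, and $z^k=x^k+\beta_k(x^k-x^{k-1})$, $G^k=\nabla_xF(z^k,B^k;\mathcal J_k)$, $y^k=x^k+\alpha_k(x^k-x^{k-1})$, $x^{k+1}=y^k-\eta_kG^k$, $B^{k+1}=B^k-\tau(\nabla_BF(x^{k+1},B^k)+\Lambda^k)$, $\Lambda^{k+1}=\arg\min_\Lambda\{h^*(\Lambda)-\langle\Lambda,2B^{k+1}-B^k\rangle+\frac\tau2\|\Lambda-\Lambda^k\|^2\}$. Convention for index $0$: $x^0=x^1$ (so $x^1=z^1=y^1$), and $B^0,\Lambda^0$ are such that the $B$- and $\Lambda$-updates also hold for $k=0$. Lyapunov function. $\Delta_x^k=\frac12\|x^k-x^{k-1}\|^2$, $\Delta_B^k=\frac12\|B^k-B^{k-1}\|^2$, $\Psi^k_{\rm sgdm}=\mathcal L(x^k,B^k,\Lambda^k)-C_1\Delta_B^{k+1}+C_2\Delta_B^k-C_3\Delta_x^{k+1}+C_4\Delta_x^k$, with $K_1=3\delta\tau^{-1}$, $K_2=2\tau^{-1}-L_F-3\delta\tau(\tau^{-1}+L_F)^2$,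 $K_3=\tau L_F^2/\delta$, $K_4=3\delta\tau L_F^2$, $C_1=K_1$, $C_2=\frac12(K_2-K_1+K_3)$, $C_3=K_4$, $C_4=\dfrac{\bar L_F+2L_F\beta^2/\alpha}{1-2\alpha-\nu}$. $\Psi^*_{\rm sgdm}$ is a lower bound of $\Psi^k_{\rm sgdm}$. SFO: one call is one evaluation of some $\nabla_xF_j$; the number of calls is the sum of the mini-batch sizes. The $\mathcal O(\cdot)$ is as $\varepsilon\to0$ with the other constants fixed. *)

(* Defs.v *)
From HB Require Import structures.
From mathcomp Require Import all_boot all_order all_algebra.
From mathcomp Require Import all_classical all_reals all_analysis.

Set Implicit Arguments.
Unset Strict Implicit.
Unset Printing Implicit Defensive.

Import Order.TTheory GRing.Theory Num.Theory.
Import numFieldNormedType.Exports.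

Local Open Scope classical_set_scope.
Local Open Scope ring_scope.

(* A finite-dimensional real Hilbert space is a normed module X of finite
   dimension with an inner product ip inducing its norm; completeness is
   automatic. *)
Definition finite_dimensional (R : realType) (X : normedModType R) : Prop :=
  exists (m : nat) (e : 'I_m -> X),
    forall x, exists c : 'I_m -> R, x = \sum_(i < m) c i *: e i.

Definition induces_norm (R : realType) (X : normedModType R)
    (ip : {dot X for idfun}) : Prop :=
  forall x : X, ip x x = `|x| ^+ 2.

(* The library norm on matrices is the max norm, hence these. *)
Definition frob_dot (R : realType) (n d : nat) (U V : 'M[R]_(n, d)) : R :=
  \sum_(i < n) \sum_(j < d) U i j * V i j.

Definition frob_norm (R : realType) (n d : nat) (U : 'M[R]_(n, d)) : R :=
  Num.sqrt (frob_dot U U).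

(* Likewise the library norm on a product is the max of the norms. *)
Definition pair_norm (R : realType) (X : normedModType R) (n d : nat)
    (x : X) (U : 'M[R]_(n, d)) : R :=
  Num.sqrt (`|x| ^+ 2 + frob_norm U ^+ 2).

(* In finite dimension continuity of every directional differential is
   continuity of the differential in operator norm. *)
Definition continuously_differentiable (R : realType) (V W : normedModType R)
    (f : V -> W) : Prop :=
  (forall x, differentiable f x) /\
  (forall v : V, continuous (fun x => 'd f x v)).

(* The Riesz representer of the differential with respect to dot; the default
   value 0 is only taken where f is not differentiable. *)
Definition grad (R : realType) (V : normedModType R) (dot : V -> V -> R)
    (f : V -> R) (x : V) : V :=
  xget 0 [set g | differentiable f x /\ forall v, 'd f x v = dot g v].

(* D maps into row vectors, so that the blocks b_i are the rows of B. *)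
Record problem (R : realType) (X : normedModType R) (n d : nat) := Problem {
  prob_f : 'I_n -> X -> R ;
  prob_D : 'I_n -> X -> 'rV[R]_d ;
  prob_gamma : R ;
  prob_h : 'rV[R]_d -> \bar R }.

Definition proper (R : realType) (V : Type) (h : V -> \bar R) : Prop :=
  (exists z, (h z < +oo)%E) /\ (-oo < ereal_inf (range h))%E.

Definition problem_regular (R : realType) (X : normedModType R) (n d : nat)
    (p : problem X n d) : Prop :=
  [/\ forall i, continuously_differentiable (prob_f p i),
      forall i, continuously_differentiable (prob_D p i),
      0 < prob_gamma p,
      lower_semicontinuous (prob_h p) & proper (prob_h p)].

Definition Fi (R : realType) (X : normedModType R) (n d : nat)
    (p : problem X n d) (i : 'I_n) (x : X) (b : 'rV[R]_d) : R :=
  prob_f p i x + prob_gamma p / 2 * frob_norm (prob_D p i x - b) ^+ 2.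

Definition F (R : realType) (X : normedModType R) (n d : nat)
    (p : problem X n d) (x : X) (B : 'M[R]_(n, d)) : R :=
  n%:R^-1 * \sum_(i < n) Fi p i x (row i B).

Definition hsum (R : realType) (X : normedModType R) (n d : nat)
    (p : problem X n d) (B : 'M[R]_(n, d)) : \bar R :=
  (\sum_(i < n) prob_h p (row i B))%E.

Definition J (R : realType) (X : normedModType R) (n d : nat)
    (p : problem X n d) (x : X) (B : 'M[R]_(n, d)) : \bar R :=
  ((F p x B)%:E + hsum p B)%E.

Definition hconj (R : realType) (X : normedModType R) (n d : nat)
    (p : problem X n d) (L : 'M[R]_(n, d)) : \bar R :=
  ereal_sup (range (fun Y => ((frob_dot L Y)%:E - hsum p Y)%E)).

Definition lagrangian (R : realType) (X : normedModType R) (n d : nat)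
    (p : problem X n d) (x : X) (B L : 'M[R]_(n, d)) : \bar R :=
  ((F p x B + frob_dot B L)%:E - hconj p L)%E.

Definition grad_x_Fi (R : realType) (X : normedModType R)
    (ip : {dot X for idfun}) (n d : nat) (p : problem X n d)
    (i : 'I_n) (x : X) (b : 'rV[R]_d) : X :=
  grad ip (fun x' => Fi p i x' b) x.

Definition grad_x_F (R : realType) (X : normedModType R)
    (ip : {dot X for idfun}) (n d : nat) (p : problem X n d)
    (x : X) (B : 'M[R]_(n, d)) : X :=
  grad ip (fun x' => F p x' B) x.

Definition grad_B_F (R : realType) (X : normedModType R) (n d : nat)
    (p : problem X n d) (x : X) (B : 'M[R]_(n, d)) : 'M[R]_(n, d) :=
  grad (@frob_dot R n d) (fun B' => F p x B') B.

Definition grad_x_batch (R : realType) (X : normedModType R)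
    (ip : {dot X for idfun}) (n d : nat) (p : problem X n d)
    (x : X) (B : 'M[R]_(n, d)) (S : {set 'I_n}) : X :=
  (#|S|%:R : R)^-1 *: \sum_(j in S) grad_x_Fi ip p j x (row j B).

(* Subdifferential of a convex function on matrices. *)
Definition subdifferential (R : realType) (n d : nat)
    (phi : 'M[R]_(n, d) -> \bar R) (L : 'M[R]_(n, d)) : set 'M[R]_(n, d) :=
  [set G | phi L \is a fin_num /\
           forall M, (phi L + (frob_dot G (M - L))%:E <= phi M)%E].

Definition lagrangian_subdiff (R : realType) (X : normedModType R)
    (ip : {dot X for idfun}) (n d : nat) (p : problem X n d)
    (x : X) (B L : 'M[R]_(n, d)) : set (X * 'M[R]_(n, d) * 'M[R]_(n, d)) :=
  ([set grad_x_F ip p x B] `*` [set grad_B_F p x B + L])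
    `*` [set B - G | G in subdifferential (hconj p) L].

(* Euclidean distance from the origin, +oo for the empty set. *)
Definition dist0 (R : realType) (X : normedModType R) (n d : nat)
    (S : set (X * 'M[R]_(n, d) * 'M[R]_(n, d))) : \bar R :=
  ereal_inf [set (Num.sqrt (`|u.1.1| ^+ 2 + frob_norm u.1.2 ^+ 2
                            + frob_norm u.2 ^+ 2))%:E | u in S].

Definition smooth (R : realType) (X : normedModType R)
    (ip : {dot X for idfun}) (n d : nat) (p : problem X n d) (LF : R) : Prop :=
  forall (x x' : X) (B B' : 'M[R]_(n, d)),
    pair_norm (grad_x_F ip p x B - grad_x_F ip p x' B')
              (grad_B_F p x B - grad_B_F p x' B')
    <= LF * pair_norm (x - x') (B - B').

(* Expectations over i uniform on 'I_n are written as averages. *)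
Definition unbiased_bounded_variance (R : realType) (X : normedModType R)
    (ip : {dot X for idfun}) (n d : nat) (p : problem X n d)
    (sigma : R) : Prop :=
  forall (x : X) (B : 'M[R]_(n, d)),
    (n%:R : R)^-1 *: \sum_(i < n) grad_x_Fi ip p i x (row i B)
      = grad_x_F ip p x B /\
    n%:R^-1 * \sum_(i < n)
        `|grad_x_Fi ip p i x (row i B) - grad_x_F ip p x B| ^+ 2
      <= sigma ^+ 2.

(* Iterates are indexed by k and by the outcome w; the minibatches are Jk k w,
   of which only those with k >= 1 are used. The run starts from the
   deterministic x0 = x1, B0, Lam0. *)
Record DualHash_StoM (R : realType) (X : normedModType R)
    (ip : {dot X for idfun}) (n d : nat) (p : problem X n d)
    (tau : R) (eta_ alpha_ beta_ : nat -> R) (Omega : Type)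
    (Jk : nat -> Omega -> {set 'I_n}) (x1 : X) (B0 Lam0 : 'M[R]_(n, d))
    (x : nat -> Omega -> X) (B Lam : nat -> Omega -> 'M[R]_(n, d)) : Prop := {
  run_x0 : forall w, x 0%N w = x1 ;
  run_x1 : forall w, x 1%N w = x1 ;
  run_B0 : forall w, B 0%N w = B0 ;
  run_Lam0 : forall w, Lam 0%N w = Lam0 ;
  run_x : forall k w, (1 <= k)%N ->
    let z := x k w + beta_ k *: (x k w - x k.-1 w) in
    let G := grad_x_batch ip p z (B k w) (Jk k w) in
    let y := x k w + alpha_ k *: (x k w - x k.-1 w) in
    x k.+1 w = y - eta_ k *: G ;
  run_B : forall k w,
    B k.+1 w = B k w - tau *: (grad_B_F p (x k.+1 w) (B k w) + Lam k w) ;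
  run_Lam : forall k w,
    let obj M := (hconj p M
      + (- frob_dot M (2 *: B k.+1 w - B k w)
         + tau / 2 * frob_norm (M - Lam k w) ^+ 2)%:E)%E in
    forall M, (obj (Lam k.+1 w) <= obj M)%E }.

Definition bounded_iterates (R : realType) (X : normedModType R) (n d : nat)
    (x : nat -> X) (B Lam : nat -> 'M[R]_(n, d)) : Prop :=
  exists M : R, forall k,
    [/\ `|x k| <= M, frob_norm (B k) <= M & frob_norm (Lam k) <= M].

Definition uniform_minibatches (R : realType) (disp : measure_display)
    (Omega : measurableType disp) (P : probability Omega R) (n : nat)
    (b_ : nat -> nat) (Jk : nat -> Omega -> {set 'I_n}) : Prop :=
  forall k, (1 <= k)%N ->
    (forall w, #|Jk k w| = b_ k) /\
    forall S : {set 'I_n}, #|S| = b_ k ->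
      measurable [set w | Jk k w = S] /\
      P [set w | Jk k w = S] = ('C(n, b_ k)%:R^-1)%:E.

Definition uniform_index (R : realType) (disp : measure_display)
    (Omega : measurableType disp) (P : probability Omega R) (T : nat)
    (rho : Omega -> nat) : Prop :=
  (forall w, (2 <= rho w <= T.+1)%N) /\
  forall r, (2 <= r <= T.+1)%N ->
    measurable [set w | rho w = r] /\
    P [set w | rho w = r] = (T%:R^-1)%:E.

Definition mutually_independent (R : realType) (disp : measure_display)
    (Omega : measurableType disp) (P : probability Omega R)
    (I : eqType) (E : I -> set (set Omega)) : Prop :=
  forall s : seq I, uniq s -> forall A : I -> set Omega,
    (forall i, i \in s -> E i (A i)) ->
    P (\big[setI/setT]_(i <- s) A i) = (\prod_(i <- s) P (A i))%E.

(* Events determined by a discrete random variable. *)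
Definition events_of (Omega S : Type) (Y : Omega -> S) : set (set Omega) :=
  [set Y @^-1` A | A in [set: set S]].

(* rho, Jk 1, Jk 2, ... are mutually independent; index 0 stands for rho. *)
Definition fresh_samples (R : realType) (disp : measure_display)
    (Omega : measurableType disp) (P : probability Omega R) (n : nat)
    (rho : Omega -> nat) (Jk : nat -> Omega -> {set 'I_n}) : Prop :=
  mutually_independent P
    (fun k => if k is 0%N then events_of rho else events_of (Jk k)).

Definition K1 (R : realType) (delta tau : R) : R := 3 * delta * tau^-1.

Definition K2 (R : realType) (LF delta tau : R) : R :=
  2 * tau^-1 - LF - 3 * delta * tau * (tau^-1 + LF) ^+ 2.

Definition K3 (R : realType) (LF delta tau : R) : R := tau * LF ^+ 2 / delta.

Definition K4 (R : realType) (LF delta tau : R) : R :=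
  3 * delta * tau * LF ^+ 2.

Definition LFbar (R : realType) (LF delta tau : R) : R :=
  2 * LF + tau * LF ^+ 2 / delta + 3 * delta * tau * LF ^+ 2.

Definition C1 (R : realType) (delta tau : R) : R := K1 delta tau.

Definition C2 (R : realType) (LF delta tau : R) : R :=
  2^-1 * (K2 LF delta tau - K1 delta tau + K3 LF delta tau).

Definition C3 (R : realType) (LF delta tau : R) : R := K4 LF delta tau.

Definition C4 (R : realType) (LF delta tau nu alpha beta : R) : R :=
  (LFbar LF delta tau + 2 * LF * beta ^+ 2 / alpha) / (1 - 2 * alpha - nu).

Definition eta_of (R : realType) (LF delta tau nu alpha beta : R) : R :=
  ((1 - 2 * alpha - nu) / 2) /
  (LFbar LF delta tau / LF
   + (1 + nu) * beta ^+ 2 / ((1 - alpha) * alpha)).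

(* The Lyapunov function along one trajectory. It is an extended real because
   the conjugate is; only k >= 1 is meaningful. *)
Definition Psi_sgdm (R : realType) (X : normedModType R) (n d : nat)
    (p : problem X n d) (LF delta tau nu alpha beta : R)
    (x : nat -> X) (B Lam : nat -> 'M[R]_(n, d)) (k : nat) : \bar R :=
  let Delta_x j := 2^-1 * `|x j - x j.-1| ^+ 2 in
  let Delta_B j := 2^-1 * frob_norm (B j - B j.-1) ^+ 2 in
  (lagrangian p (x k) (B k) (Lam k)
   + (- C1 delta tau * Delta_B k.+1
      + C2 LF delta tau * Delta_B k
      - C3 LF delta tau * Delta_x k.+1
      + C4 LF delta tau nu alpha beta * Delta_x k)%:E)%E.

(* Producing the iterates up to index T + 1 takes the iterations 1, ..., T. *)
Definition sfo_calls (n : nat) (Omega : Type)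
    (Jk : nat -> Omega -> {set 'I_n}) (T : nat) (w : Omega) : nat :=
  \sum_(1 <= k < T.+1) #|Jk k w|.

(* Main.v *)
Require Import Defs.
From HB Require Import structures.
From mathcomp Require Import all_boot all_order all_algebra.
From mathcomp Require Import all_classical all_reals all_analysis.
From mathcomp Require Import ring lra.

(* Along one trajectory, the prox step says that
   2 B^(k+1) - B^k - tau (Lam^(k+1) - Lam^k) is a subgradient of h^* at
   Lam^(k+1), and the B-step expresses Lam^k through B^(k+1) - B^k and a
   gradient. Descent of F in x and in B, convexity of h^* and Young's inequality
   then give Psi^(k+1) <= Psi^k - (LF/2) S_k - <xi_k, x^(k+1) - x^k>, where S_k
   adds up the squared increments of x and B and xi_k is the minibatch error.
   The same relations bound dist^2(0, dL) at index k by 4 |xi_k|^2 + C S_k.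
   Since x^(k+1) - x^k = a_k - eta_k xi_k with a_k depending only on the past,
   E<xi_k, x^(k+1) - x^k> = - eta_k E|xi_k|^2, and E|xi_k|^2 <= sigma^2 / b for
   sampling without replacement. Summing over k = 1, ..., T+1 and dividing by T
   gives the rate; the run up to index T+2 is needed because dist^2 at index k
   is controlled by increments at k+1.
   Minibatches range over a finite set, so a quantity at step k is a function
   of a random variable with finitely many values; this gives measurability and
   integrability, and turns conditioning into finite sums. *)

Set Implicit Arguments.
Unset Strict Implicit.
Unset Printing Implicit Defensive.

Import Order.TTheory GRing.Theory Num.Theory.
Import numFieldNormedType.Exports.

Local Open Scope classical_set_scope.
Local Open Scope ring_scope.

(** * Finite-dimensional inner products *)

(** Interface shared by [frob_dot] and [ip], so that each estimate is proved once for both. Squared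
    norms are written [dot u u] because the library norm on matrices is the max norm. *)
Record inner_product (R : realType) (V : lmodType R) (dot : V -> V -> R)
    : Prop := InnerProduct {
  dotC : forall u v, dot u v = dot v u ;
  dotDl : forall u v w, dot (u + v) w = dot u w + dot v w ;
  dotZl : forall a u v, dot (a *: u) v = a * dot u v ;
  dot_gt0 : forall u, u != 0 -> 0 < dot u u }.

Section InnerProduct.
Context (R : realType) (V : lmodType R) (dot : V -> V -> R).
Hypothesis hdot : inner_product dot.
Implicit Types u v w : V.

Lemma dotDr u v w : dot u (v + w) = dot u v + dot u w.
Proof. by rewrite (dotC hdot) (dotDl hdot) !(dotC hdot u). Qed.

Lemma dotZr a u v : dot u (a *: v) = a * dot u v.
Proof. by rewrite (dotC hdot) (dotZl hdot) (dotC hdot u). Qed.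

Lemma dotNl u v : dot (- u) v = - dot u v.
Proof. by rewrite -scaleN1r (dotZl hdot) mulN1r. Qed.

Lemma dotNr u v : dot u (- v) = - dot u v.
Proof. by rewrite (dotC hdot) dotNl (dotC hdot u). Qed.

Lemma dot0l v : dot 0 v = 0.
Proof. by rewrite -(scale0r 0) (dotZl hdot) mul0r. Qed.

Lemma dot0r v : dot v 0 = 0.
Proof. by rewrite (dotC hdot) dot0l. Qed.

Lemma dot_ge0 u : 0 <= dot u u.
Proof.
have [->|/(dot_gt0 hdot)/ltW//] := eqVneq u 0.
by rewrite dot0l.
Qed.

Lemma dot_sumr (I : Type) (r : seq I) (P : pred I) (F : I -> V) u :
  dot u (\sum_(i <- r | P i) F i) = \sum_(i <- r | P i) dot u (F i).
Proof.
elim/big_rec2: _ => [|i y1 y2 _ <-]; first by rewrite dot0r.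
by rewrite dotDr.
Qed.

Lemma dot_suml (I : Type) (r : seq I) (P : pred I) (F : I -> V) u :
  dot (\sum_(i <- r | P i) F i) u = \sum_(i <- r | P i) dot (F i) u.
Proof.
by rewrite (dotC hdot) dot_sumr; apply: eq_bigr => i _; exact: dotC.
Qed.

Lemma dot_eq0 u : dot u u <= 0 -> u = 0.
Proof.
move=> u0; apply/eqP; apply: contraT => /(dot_gt0 hdot).
by rewrite ltNge u0.
Qed.

(** Expand the nonnegative square of [a *: u - v] and divide by [a]. *)
Lemma dot_young a u v : 0 < a ->
  2 * dot u v <= a * dot u u + a^-1 * dot v v.
Proof.
move=> a0; have := dot_ge0 (a *: u - v).
rewrite !(dotDl hdot, dotDr, dotNl, dotNr, dotZl hdot, dotZr) (dotC hdot v u).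
have aV0 : 0 < a^-1 by rewrite invr_gt0.
move=> /(mulr_ge0 (ltW aV0)).
have aV : a^-1 * a = 1 by rewrite mulVf// gt_eqF.
have -> : a^-1 * (a * (a * dot u u) - a * dot u v
   - (a * dot u v - dot v v)) = (a^-1 * a) * (a * dot u u)
   - 2 * (a^-1 * a) * dot u v + a^-1 * dot v v by ring.
rewrite aV; lra.
Qed.

Lemma dot_add_le a u v : 0 < a ->
  dot (u + v) (u + v) <= (1 + a) * dot u u + (1 + a^-1) * dot v v.
Proof.
move=> a0; have := dot_young u v a0.
rewrite !(dotDl hdot, dotDr) (dotC hdot v u); lra.
Qed.

Lemma dot_add2_le u v : dot (u + v) (u + v) <= 2 * dot u u + 2 * dot v v.
Proof. by have := dot_add_le u v ltr01; rewrite invr1; lra. Qed.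

Lemma dot_add3_le u v w :
  dot (u + v + w) (u + v + w) <= 3 * dot u u + 3 * dot v v + 3 * dot w w.
Proof.
have := dot_young u v ltr01; have := dot_young u w ltr01.
have := dot_young v w ltr01.
rewrite !(dotDl hdot, dotDr) (dotC hdot v u) (dotC hdot w u) (dotC hdot w v).
rewrite invr1; lra.
Qed.

(* The second clause says that g is in the span of s without naming
   coefficients. *)
Lemma riesz_seq (s : seq V) (l : V -> R) :
    (forall a u v, l (a *: u + v) = a * l u + l v) ->
  exists2 g, forall v, v \in s -> dot g v = l v
  & forall l' : V -> R, (forall a u v, l' (a *: u + v) = a * l' u + l' v) ->
      (forall v, v \in s -> l' v = 0) -> l' g = 0.
Proof.
elim: s l => [|e s IH] l ll.
  exists 0 => // l' ll' _; have := ll' (-1) 0 0.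
  by rewrite scaleN1r oppr0 addr0; lra.
have [g gl gs] := IH _ ll.
(* Applied to [dot e], the induction hypothesis yields the orthogonal projection [p] of [e] onto the
   span of [s]. *)
have [p pe ps] := IH (dot e) (fun a u v =>
  etrans (dotDr e (a *: u) v) (congr1 (+%R^~ _) (dotZr a e u))).
have lin0 (f : V -> R) : (forall a u v, f (a *: u + v) = a * f u + f v) ->
    f 0 = 0.
  by move=> /(_ (-1) 0 0); rewrite scaleN1r oppr0 addr0; lra.
have linB (f : V -> R) u v :
    (forall a u v, f (a *: u + v) = a * f u + f v) -> f (u - v) = f u - f v.
  by move=> lf; rewrite addrC -scaleN1r lf mulN1r addrC.
(* If [e] is already in the span, [g] stays: the form [dot g - l] vanishes on [s], hence at
   [p = e]. *)
have [rE|r0] := eqVneq (e - p) 0.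
  have ep : e = p by apply/eqP; rewrite -subr_eq0 rE.
  exists g => [v|l' ll' l's]; last first.
    by apply: gs => // v vs; apply: l's; rewrite inE vs orbT.
  rewrite inE => /predU1P[->|]; last exact: gl.
  apply/eqP; rewrite -subr_eq0 ep; apply/eqP.
  apply: (ps (fun v => dot g v - l v)) => [a u w|w ws].
    by rewrite dotDr dotZr ll; ring.
  by rewrite gl// subrr.
have rs v : v \in s -> dot (e - p) v = 0.
  by move=> vs; rewrite (dotDl hdot) dotNl pe// subrr.
have rp : dot (e - p) p = 0.
  by apply: (ps (dot (e - p))) => // a u v; rewrite dotDr dotZr.
have re : 0 < dot (e - p) e.
  by have := dot_gt0 hdot r0; rewrite dotDr dotNr rp subr0.
set r := e - p in rs rp re.
(* Correcting along the residual [r], orthogonal to [s], fixes the value at [e] without changing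
   those on [s]. *)
exists (g + ((l e - dot g e) / dot r e) *: r) => [v|l' ll' l's].
  rewrite (dotDl hdot) (dotZl hdot) inE => /predU1P[->|vs].
    by rewrite divfK ?gt_eqF//; ring.
  by rewrite (rs v vs) mulr0 addr0 gl.
have l's' v : v \in s -> l' v = 0.
  by move=> vs; apply: l's; rewrite inE vs orbT.
rewrite addrC ll' gs// addr0 linB// ps// (l's e) ?mem_head//.
by rewrite subr0 mulr0.
Qed.

End InnerProduct.

Lemma frob_inner (R : realType) (n d : nat) : inner_product (@frob_dot R n d).
Proof.
split=> [U V|U V W|a U V|U U0].
- by apply: eq_bigr => i _; apply: eq_bigr => j _; rewrite mulrC.
- rewrite /frob_dot -big_split; apply: eq_bigr => i _.
  by rewrite -big_split; apply: eq_bigr => j _; rewrite mxE mulrDl.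
- rewrite /frob_dot mulr_sumr; apply: eq_bigr => i _.
  by rewrite mulr_sumr; apply: eq_bigr => j _; rewrite mxE mulrA.
- have /existsP[i /existsP[j Uij]] : [exists i, exists j, U i j != 0].
    apply: contra_neqT U0 => /existsPn/= h; apply/matrixP => i j.
    by have /existsPn/(_ j)/negPn/eqP -> := h i; rewrite mxE.
  rewrite /frob_dot (bigD1 i)//= (bigD1 j)//=.
  rewrite -addrA ltr_pwDl//.
    by rewrite lt_neqAle eq_sym mulf_neq0//= -expr2 sqr_ge0.
  by rewrite addr_ge0//; do ?apply: sumr_ge0 => ? _; rewrite -?expr2 ?sqr_ge0.
Qed.

Lemma frob_normE (R : realType) (n d : nat) (U : 'M[R]_(n, d)) :
  frob_norm U ^+ 2 = frob_dot U U.
Proof. by rewrite sqr_sqrtr// (dot_ge0 (frob_inner R n d)). Qed.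

Lemma dot_for_inner (R : realType) (X : normedModType R)
    (ip : {dot X for idfun}) : inner_product ip.
Proof.
split=> [u v|u v w|a u v|u u0].
- by rewrite hermC/= expr0 mul1r.
- by rewrite linearDl.
- by rewrite linearZl_LR.
- exact: neq0_dnorm_gt0.
Qed.

(** * Gradients and descent *)

(** The mean value theorem is applied to [psi], the function along the segment minus its quadratic
    model. Young with weight [(L * c)^-1] and the Lipschitz bound show that its derivative at [c] is
    at most 0. *)
Lemma descent (R : realType) (V : normedModType R) (dot : V -> V -> R)
    (f : V -> R) (g : V -> V) (L : R) :
    inner_product dot -> 0 < L ->
    (forall x, differentiable f x) ->
    (forall x v, 'd f x v = dot (g x) v) ->
    (forall x y, dot (g x - g y) (g x - g y) <= L ^+ 2 * dot (x - y) (x - y)) ->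
  forall x y, f y <= f x + dot (g x) (y - x) + L / 2 * dot (y - x) (y - x).
Proof.
move=> hdot L0 df gf gL x y; set v := y - x.
pose l (t : R) := x + t *: v.
have dl (t : R) : is_diff t l (fun h : R => h *: v).
  by apply: is_diff_eq; apply/funext => h /=; rewrite /GRing.add /= add0r.
have dfl (t : R) : is_derive t (1 : R) (f \o l) (dot (g (l t)) v).
  have dfl' : differentiable (f \o l) t by exact: differentiable_comp.
  apply: DeriveDef; first exact/diff_derivable.
  by rewrite deriveE// diff_comp//= diff_val scale1r gf.
pose psi (t : R) := (f \o l) t - (t * dot (g x) v + L / 2 * dot v v * t ^+ 2).
have dpsi (t : R) : is_derive t (1 : R) psi
    (dot (g (l t)) v - (dot (g x) v + L * dot v v * t)).
  have E (a b c s : R) :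
      a - (s * 0 + b * 1 + L / 2 * c * (s * 1 + s * 1)) = a - (b + L * c * s).
    by field.
  by apply: is_derive_eq; exact: E.
have cpsi : {within `[0 : R, 1], continuous psi}.
  apply: continuous_subspaceT => t.
  by apply: differentiable_continuous; apply/derivable1_diffP; exact: ex_derive.
have [c] := MVT ltr01 (fun t _ => dpsi t) cpsi.
rewrite in_itv/= => /andP[c0 c1].
have -> : psi 0 = f x.
  by rewrite /psi/= /l scale0r addr0 mul0r expr0n/= mulr0 addr0 subr0.
have -> : psi 1 = f y - (dot (g x) v + L / 2 * dot v v).
  by rewrite /psi/= /l scale1r mul1r expr1n mulr1 [x + v]addrC subrK.
suff : dot (g (l c)) v - dot (g x) v <= L * c * dot v v by lra.
rewrite -(dotNl hdot) -(dotDl hdot).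
have Lc0 : 0 < L * c by rewrite mulr_gt0.
have Lc0V : 0 < (L * c)^-1 by rewrite invr_gt0.
have := dot_young hdot (g (l c) - g x) v Lc0V; rewrite invrK.
have := gL (l c) x.
have -> : l c - x = c *: v by rewrite /l addrC addKr.
rewrite (dotZl hdot) (dotZr hdot) => H1.
have := ler_wpM2l (ltW Lc0V) H1.
have -> : (L * c)^-1 * (L ^+ 2 * (c * (c * dot v v))) = L * c * dot v v.
  by field; rewrite !gt_eqF.
lra.
Qed.

(** The spanning family may be linearly dependent; [riesz_seq] copes with this through its
    zero-residual case. *)
Lemma finite_dimensional_riesz (R : realType) (X : normedModType R)
    (dot : X -> X -> R) (l : X -> R) :
    finite_dimensional X -> inner_product dot ->
    (forall a u v, l (a *: u + v) = a * l u + l v) ->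
  exists g, forall v, l v = dot g v.
Proof.
move=> [m [e espan]] hdot ll.
have [g gl _] := riesz_seq hdot (codom e) ll.
exists g => v; have [c ->] := espan v.
have l0 : l 0 = 0.
  by have := ll (-1) 0 0; rewrite scaleN1r oppr0 addr0; lra.
have lD u w : l (u + w) = l u + l w.
  by rewrite -[u]scale1r ll scale1r mul1r.
rewrite (dot_sumr hdot) (big_morph l lD l0); apply: eq_bigr => i _.
by rewrite -[c i *: e i]addr0 ll l0 !addr0 (dotZr hdot) gl ?codom_f.
Qed.

Lemma frob_riesz (R : realType) (n d : nat) (l : 'M[R]_(n, d) -> R) :
    (forall a u v, l (a *: u + v) = a * l u + l v) ->
  exists g, forall v, l v = frob_dot g v.
Proof.
move=> ll; exists (\matrix_(i, j) l (delta_mx i j)) => v.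
have l0 : l 0 = 0.
  by have := ll (-1) 0 0; rewrite scaleN1r oppr0 addr0; lra.
have lD u w : l (u + w) = l u + l w.
  by rewrite -[u]scale1r ll scale1r mul1r.
rewrite {1}[v]matrix_sum_delta (big_morph l lD l0) /frob_dot.
apply: eq_bigr => i _; rewrite (big_morph l lD l0); apply: eq_bigr => j _.
by rewrite -[_ *: _]addr0 ll l0 addr0 mxE mulrC.
Qed.

(** Riesz representation makes the set from which [grad] chooses inhabited, so the default value is
    not taken. *)
Lemma gradP (R : realType) (V : normedModType R) (dot : V -> V -> R)
    (f : V -> R) (x : V) :
    (forall l : V -> R, (forall a u v, l (a *: u + v) = a * l u + l v) ->
       exists g, forall v, l v = dot g v) ->
  differentiable f x -> forall v, 'd f x v = dot (grad dot f x) v.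
Proof.
move=> riesz df; have [g gE] : exists g, forall v, 'd f x v = dot g v.
  by apply: riesz => a u v; rewrite linearP.
by have [] := @xgetPex _ (0 : V) [set g | differentiable f x /\
  forall v, 'd f x v = dot g v] (ex_intro _ g (conj df gE)).
Qed.

(** * Differentiability of the objective in each variable *)

Lemma differentiable_sqr (R : realType) (V : normedModType R) (f : V -> R) x :
  differentiable f x -> differentiable (fun y => f y * f y) x.
Proof. by move=> df; exact: differentiableM. Qed.

Lemma differentiable_pointwise_sum (R : realType) (V : normedModType R)
    (m : nat) (f : 'I_m -> V -> R) (x : V) : (forall i, differentiable (f i) x) ->
  differentiable (fun y => \sum_(i < m) f i y) x.
Proof. by move=> /differentiable_sum; rewrite fct_sumE. Qed.

Lemma differentiable_frob_dot (R : realType) (V : normedModType R) (n d : nat)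
    (U : V -> 'M[R]_(n, d)) (x : V) :
    (forall i j, differentiable (fun y => U y i j) x) ->
  differentiable (fun y => frob_dot (U y) (U y)) x.
Proof.
move=> dU; apply: differentiable_pointwise_sum => i.
by apply: differentiable_pointwise_sum => j; exact: differentiable_sqr.
Qed.

Section ObjectiveRegularity.
Context (R : realType) (X : normedModType R) (n d : nat) (p : problem X n d).
Hypothesis hp : problem_regular p.

Lemma differentiable_F_x (B : 'M[R]_(n, d)) x :
  differentiable (fun x' => F p x' B) x.
Proof.
have [df dD _ _ _] := hp.
apply: differentiableM => //; apply: differentiable_pointwise_sum => i.
apply: differentiableD; first exact: (df i).1.
apply: differentiableM => //.
under eq_fun do rewrite frob_normE.
apply: differentiable_frob_dot => k j.
under eq_fun do rewrite !mxE.
apply: differentiableB => //.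
apply: (@differentiable_comp _ _ _ _ (prob_D p i) (fun N : 'rV_d => N k j)).
  exact: (dD i).1.
exact: differentiable_coord.
Qed.

Lemma differentiable_F_B (x : X) (B : 'M[R]_(n, d)) :
  differentiable (fun B' => F p x B') B.
Proof.
apply: differentiableM => //; apply: differentiable_pointwise_sum => i.
apply: differentiableD => //.
apply: differentiableM => //.
under eq_fun do rewrite frob_normE.
apply: differentiable_frob_dot => k j.
under eq_fun do rewrite !mxE.
apply: differentiableB => //.
exact: differentiable_coord.
Qed.

End ObjectiveRegularity.

(** * Blockwise Lipschitz gradients and descent inequalities *)

Lemma sqr_pair_norm (R : realType) (X : normedModType R) (n d : nat)
    (x : X) (U : 'M[R]_(n, d)) :
  pair_norm x U ^+ 2 = `|x| ^+ 2 + frob_dot U U.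
Proof. by rewrite -frob_normE sqr_sqrtr// addr_ge0// sqr_ge0. Qed.

Section Smoothness.
Context (R : realType) (X : normedModType R) (ip : {dot X for idfun})
  (n d : nat) (p : problem X n d) (LF : R).
Hypotheses (hX : finite_dimensional X) (hip : induces_norm ip)
  (hp : problem_regular p) (LF0 : 0 < LF) (hs : smooth ip p LF).
Local Notation fdot := (@frob_dot R n d).

(** Squaring makes the joint bound additive in the two blocks, so that dropping a nonnegative term
    gives the blockwise bounds. *)
Lemma smooth_sqr x x' B B' :
  ip (grad_x_F ip p x B - grad_x_F ip p x' B')
     (grad_x_F ip p x B - grad_x_F ip p x' B')
  + fdot (grad_B_F p x B - grad_B_F p x' B')
         (grad_B_F p x B - grad_B_F p x' B')
  <= LF ^+ 2 * (ip (x - x') (x - x') + fdot (B - B') (B - B')).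
Proof.
have := hs x x' B B' => H.
have := lerXn2r 2 (sqrtr_ge0 _) (le_trans (sqrtr_ge0 _) H) H.
by rewrite exprMn !sqr_pair_norm -!hip.
Qed.

Lemma smooth_x x x' B :
  ip (grad_x_F ip p x B - grad_x_F ip p x' B)
     (grad_x_F ip p x B - grad_x_F ip p x' B)
  <= LF ^+ 2 * ip (x - x') (x - x').
Proof.
have := smooth_sqr x x' B B.
rewrite (subrr B) (dot0l (frob_inner R n d) 0) addr0.
have := dot_ge0 (frob_inner R n d) (grad_B_F p x B - grad_B_F p x' B); lra.
Qed.

Lemma smooth_B x x' B B' :
  fdot (grad_B_F p x B - grad_B_F p x' B') (grad_B_F p x B - grad_B_F p x' B')
  <= LF ^+ 2 * (ip (x - x') (x - x') + fdot (B - B') (B - B')).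
Proof.
have := smooth_sqr x x' B B'.
have := dot_ge0 (dot_for_inner ip) (grad_x_F ip p x B - grad_x_F ip p x' B').
lra.
Qed.

Lemma descent_x x y B :
  F p y B <= F p x B + ip (grad_x_F ip p x B) (y - x)
             + LF / 2 * ip (y - x) (y - x).
Proof.
apply: (@descent _ _ _ (fun x => F p x B) (fun x => grad_x_F ip p x B)) => //.
- exact: dot_for_inner.
- exact: differentiable_F_x.
- move=> z; apply: gradP; last exact: differentiable_F_x.
  by move=> l; apply: finite_dimensional_riesz => //; exact: dot_for_inner.
- by move=> z z'; exact: smooth_x.
Qed.

Lemma descent_B x B C :
  F p x C <= F p x B + fdot (grad_B_F p x B) (C - B)
             + LF / 2 * fdot (C - B) (C - B).
Proof.
apply: (@descent _ _ _ (fun B => F p x B) (fun B => grad_B_F p x B)) => //.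
- exact: frob_inner.
- exact: differentiable_F_B.
- move=> z; apply: gradP; last exact: differentiable_F_B.
  exact: frob_riesz.
- move=> z z'; have := smooth_B x x z z'.
  by rewrite (subrr x) (dot0l (dot_for_inner ip) 0) add0r.
Qed.

End Smoothness.

(** * The conjugate and its proximal step *)

Section Conjugate.
Context (R : realType) (X : normedModType R) (n d : nat) (p : problem X n d).
Hypothesis hp : problem_regular p.
Local Notation fdot := (@frob_dot R n d).
Local Notation hfrob := (frob_inner R n d).
Implicit Types A B L M Y : 'M[R]_(n, d).

Lemma hconj_ub L Y : ((fdot L Y)%:E - hsum p Y <= hconj p L)%E.
Proof. by apply: ereal_sup_ubound; exists Y. Qed.

Lemma proper_bounded_below : exists m : R, forall z, (m%:E <= prob_h p z)%E.
Proof.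
have [_ _ _ _ [_ hinf]] := hp.
have lb z : (ereal_inf (range (prob_h p)) <= prob_h p z)%E.
  by apply: ereal_inf_lbound; exists z.
case: (ereal_inf _) hinf lb => [m _ lb|_ lb|//]; first by exists m.
by exists 0 => z; apply: le_trans (lb z); rewrite leey.
Qed.

Lemma hsum_bounded_below : exists m : R, forall Y, (m%:E <= hsum p Y)%E.
Proof.
have [m hm] := proper_bounded_below; exists (\sum_(i < n) m) => Y.
by rewrite -sumEFin; apply: lee_sum => i _; exact: hm.
Qed.

(** The matrix whose rows all equal a point of the domain of [h] contributes a finite term to the
    supremum. *)
Lemma hconj_gtNy L : (-oo < hconj p L)%E.
Proof.
have [_ _ _ _ [[z zoo] _]] := hp; have [m hm] := proper_bounded_below.
apply: lt_le_trans (hconj_ub L (\matrix_(i < n) z)).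
have zfin : prob_h p z \is a fin_num.
  by rewrite fin_numElt zoo andbT (lt_le_trans _ (hm z))// ltNyr.
rewrite /hsum; under eq_bigr do rewrite rowK -(fineK zfin).
by rewrite sumEFin ltNyr.
Qed.

Lemma hconj_0_lty : (hconj p 0 < +oo)%E.
Proof.
have [m hm] := hsum_bounded_below.
apply: (@le_lt_trans _ _ (- m)%:E); last by rewrite ltry.
apply: ub_ereal_sup => _ [Y _ <-].
by rewrite (dot0l hfrob) add0e EFinN leeN2.
Qed.

(** A supremum of affine functions. Where [hsum] is [+oo] the term is [-oo]; the value [-oo] is
    excluded by the lower bound on [hsum]. *)
Lemma hconj_convex A B (a b t : R) : 0 <= t <= 1 ->
    hconj p A = a%:E -> hconj p B = b%:E ->
  (hconj p (A + t *: (B - A)) <= ((1 - t) * a + t * b)%:E)%E.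
Proof.
move=> /andP[t0 t1] hA hB; apply: ub_ereal_sup => _ [Y _ <-].
have := hconj_ub A Y; have := hconj_ub B Y; rewrite {}hA {}hB.
have [m /(_ Y)] := hsum_bounded_below.
case: (hsum p Y) => [r _|_ _ _|//]; last by rewrite leNye.
rewrite -!EFinD !lee_fin !(dotDl hfrob, dotZl hfrob, dotNl hfrob) => hb ha.
have t1' : 0 <= 1 - t by rewrite subr_ge0.
have := lerD (ler_wpM2l t1' ha) (ler_wpM2l t0 hb); lra.
Qed.

(** Minimality is tested at [L + t *: (M - L)]. Convexity of the conjugate, division by [t] and [t]
    tending to 0 remove the quadratic remainder. *)
Lemma prox_subdifferential (tau : R) C L0 L : 0 < tau ->
    (forall M, (hconj p L + (- fdot L C + tau / 2 * frob_norm (L - L0) ^+ 2)%:E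
      <= hconj p M + (- fdot M C + tau / 2 * frob_norm (M - L0) ^+ 2)%:E)%E) ->
  subdifferential (hconj p) L (C - tau *: (L - L0)).
Proof.
move=> tau0 hmin.
(* Comparison with [M = 0], where the conjugate is finite since [h] is bounded below, rules out
   [+oo]. *)
have Lfin : hconj p L \is a fin_num.
  rewrite fin_numElt hconj_gtNy /=.
  have f0 : hconj p 0 \is a fin_num.
    by rewrite fin_numElt hconj_gtNy hconj_0_lty.
  have := hmin 0; rewrite -(fineK f0) -EFinD.
  by case: (hconj p L) => [r|/=|] H; rewrite ?ltry ?ltNyr.
split=> // M; have := hconj_gtNy M; move E : (hconj p M) => hM.
case: hM E => [r|//|//] E _; last by rewrite leey.
move: hmin; rewrite -(fineK Lfin); set a := fine _ => hmin.
have aE : hconj p L = a%:E by rewrite /a fineK.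
rewrite -EFinD lee_fin.
set D := M - L; set q := fdot _ D.
have key t : 0 < t -> t <= 1 -> a + q <= r + t * (tau / 2 * fdot D D).
  move=> t0 t1.
  have t01 : 0 <= t <= 1 by rewrite ltW.
  have := le_trans (hmin (L + t *: D)) (leeD2r _ (hconj_convex t01 aE E)).
  rewrite -!EFinD lee_fin !frob_normE [L + t *: D - L0]addrAC /q {q}.
  set U := L - L0; clearbody U D.
  rewrite !(dotDl hfrob, dotDr hfrob, dotZl hfrob, dotZr hfrob, dotNl hfrob).
  rewrite (dotC hfrob D U) (dotC hfrob D C) => H.
  rewrite -(ler_pM2l t0); lra.
apply/ler_addgt0Pr => e e0; set w := tau / 2 * fdot D D in key.
have w0 : 0 <= w by rewrite mulr_ge0 ?divr_ge0 ?(ltW tau0) ?(dot_ge0 hfrob).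
have w1 : 0 < w + 1 by rewrite ltr_wpDl.
(* The choice [t = min(1, e / (w + 1))] makes the remainder [t * w] at most [e]. *)
have [ew|ew] := leP 1 (e / (w + 1)).
  apply: le_trans (key 1 _ _) _ => //; rewrite mul1r lerD2l.
  by move: ew; rewrite ler_pdivlMr// mul1r; lra.
apply: le_trans (key (e / (w + 1)) _ (ltW ew)) _; first by rewrite divr_gt0.
rewrite lerD2l mulrAC ler_pdivrMr// ler_pM2l//; lra.
Qed.

Lemma subdifferential_monotone A B G H :
    subdifferential (hconj p) A G -> subdifferential (hconj p) B H ->
  0 <= fdot (G - H) (A - B).
Proof.
move=> [Afin hA] [Bfin hB]; have := hA B; have := hB A.
rewrite -(fineK Afin) -(fineK Bfin) -!EFinD !lee_fin.
rewrite !(dotDl hfrob, dotDr hfrob, dotNl hfrob, dotNr hfrob); lra.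
Qed.

(** The two subgradients differ by [- tau *: (L - L')], so monotonicity forces [L = L']. This is
    what makes the dual iterate, given only as a minimizer, a function of the past. *)
Lemma prox_unique (tau : R) C L0 L L' : 0 < tau ->
    subdifferential (hconj p) L (C - tau *: (L - L0)) ->
    subdifferential (hconj p) L' (C - tau *: (L' - L0)) -> L = L'.
Proof.
move=> tau0 hL hL'; have := subdifferential_monotone hL hL'.
have -> : C - tau *: (L - L0) - (C - tau *: (L' - L0)) = - tau *: (L - L').
  rewrite opprB addrC addrA subrK -scalerBr opprB addrA subrK.
  by rewrite scaleNr -scalerN opprB.
rewrite (dotZl hfrob) mulNr oppr_ge0 pmulr_rle0// => /(dot_eq0 hfrob)/eqP.
by rewrite subr_eq0 => /eqP.
Qed.

End Conjugate.

(** * Constants of the Lyapunov function *)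

Section Coefficients.
Context (R : realType) (LF delta tau nu alpha beta : R).
Hypotheses (LF0 : 0 < LF) (delta0 : 0 < delta) (tau0 : 0 < tau)
  (nu01 : 0 < nu < 1) (al0 : 0 < alpha < (1 - nu) / 2) (be0 : 0 < beta < 1).
Local Notation eta := (eta_of LF delta tau nu alpha beta).
Local Notation Lb := (LFbar LF delta tau).

Lemma LFbar_ge : 2 * LF <= Lb.
Proof.
rewrite /LFbar -addrA lerDl addr_ge0// ?divr_ge0// ?mulr_ge0 ?sqr_ge0//;
  exact: ltW.
Qed.

(** The two inequalities are what the new and the old squared x-increments require in
    [lyapunov_arith]. With [m], [c], [q] as below, [LF / eta = 2 * (Lb + q * c) / m] and
    [C4 = (Lb + 2 * c) / m], and [1 <= q <= 2] leaves the needed slack. *)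
Lemma step_coefficients : [/\ 0 < eta,
  LF / 2 <= LF / eta * (1 - alpha / 2) - Lb / 2
            - C4 LF delta tau nu alpha beta / 2
  & LF <= C4 LF delta tau nu alpha beta / 2 - LF / eta * alpha / 2].
Proof.
have /andP[nu0 nu1] := nu01; have /andP[a0 a1] := al0.
have /andP[b0 b1] := be0.
have Lb2 := LFbar_ge.
have Lb0 : 0 < Lb by apply: lt_le_trans Lb2; rewrite mulr_gt0.
pose m := 1 - 2 * alpha - nu; have m0 : 0 < m by rewrite /m; lra.
have m1 : m <= 1 by rewrite /m; lra.
pose c := LF * beta ^+ 2 / alpha.
have c0 : 0 < c by rewrite divr_gt0// mulr_gt0// exprn_gt0.
have a1' : 0 < 1 - alpha by lra.
pose q := (1 + nu) / (1 - alpha).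
have q1 : 1 <= q by rewrite /q ler_pdivlMr//; lra.
have q2 : q <= 2 by rewrite /q ler_pdivrMr//; lra.
have etaE : eta = (m / 2) / ((Lb + q * c) / LF).
  rewrite /eta_of -/m /q /c; congr (_ / _); field.
  by rewrite !gt_eqF.
have Lqc0 : 0 < Lb + q * c by rewrite addr_gt0// mulr_gt0//; lra.
have eta0 : 0 < eta by rewrite etaE !divr_gt0.
have eE : LF / eta = 2 * (Lb + q * c) / m.
  rewrite etaE; field; rewrite !gt_eqF//.
have C4E : C4 LF delta tau nu alpha beta = (Lb + 2 * c) / m.
  by rewrite /C4 -/m /c; congr (_ / _); ring.
have qa : q * alpha <= 1.
  have : q * alpha <= 2 * alpha by rewrite ler_pM2r.
  by lra.
have cq1 : 0 <= c * (2 * q - q * alpha - 1).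
  by rewrite mulr_ge0 ?(ltW c0)//; lra.
have cq2 : 0 <= c * (1 - q * alpha).
  by rewrite mulr_ge0 ?(ltW c0)//; lra.
have Lnu : 0 <= Lb * nu by rewrite mulr_ge0// ltW.
have LFm : LF * m <= LF by rewrite ger_pMr.
have La : 2 * LF * (1 / 2 - alpha) <= Lb * (1 / 2 - alpha).
  by rewrite ler_pM2r//; lra.
have LFnu : 0 <= LF * nu by rewrite mulr_ge0// ltW.
split=> //; rewrite eE C4E.
- have -> : 2 * (Lb + q * c) / m * (1 - alpha / 2) - Lb / 2
        - (Lb + 2 * c) / m / 2
     = (Lb * (1 + nu / 2) + c * (2 * q - q * alpha - 1)) / m.
    by rewrite /m; field; rewrite gt_eqF.
  by rewrite ler_pdivlMr//; lra.
- have -> : (Lb + 2 * c) / m / 2 - 2 * (Lb + q * c) / m * alpha / 2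
     = (Lb * (1 / 2 - alpha) + c * (1 - q * alpha)) / m.
    by field; rewrite gt_eqF.
  rewrite ler_pdivlMr//; move: La cq2 LFnu; rewrite /m; lra.
Qed.

(* With s = tau * LF <= delta, multiplying by tau turns this into
   3 delta + s^2 / delta + 2 s <= 2 - s - 3 delta (1 + s)^2, which holds with
   room to spare for delta = 1/12. *)
Lemma K_gap : delta = 12^-1 -> tau * LF <= delta ->
  K1 delta tau + K3 LF delta tau + 2 * LF <= K2 LF delta tau.
Proof.
move=> dE s1; pose s := tau * LF; have s0 : 0 < s by rewrite mulr_gt0.
have ss : s ^+ 2 <= 12^-1 * s.
  by rewrite expr2 ler_pM2r// /s -dE.
rewrite -(ler_pM2l tau0).
have -> : tau * (K1 delta tau + K3 LF delta tau + 2 * LF)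
    = 3 * delta + s ^+ 2 / delta + 2 * s.
  by rewrite /K1 /K3 /s; field; rewrite !gt_eqF.
have -> : tau * K2 LF delta tau = 2 - s - 3 * delta * (1 + s) ^+ 2.
  by rewrite /K2 /s; field; rewrite gt_eqF.
rewrite dE invrK; rewrite dE -/s in s1; lra.
Qed.

End Coefficients.

(** Young with weight [delta] separates the gradient increment [g] from the dual increment [W]. The
    three pieces of [W] stand for the next B-increment, the current one with the gradient change it
    causes, and the gradient change due to x. *)
Lemma dual_step (R : realType) (V : lmodType R) (dot : V -> V -> R)
    (LF delta tau a1 a2 : R) (D1 D2 D3 W g p q : V) :
    inner_product dot -> 0 < LF -> 0 < delta -> 0 < tau ->
    W = - tau^-1 *: D3 + (tau^-1 *: D2 - p) - q ->
    dot g g <= LF ^+ 2 * (a1 + dot D1 D1) ->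
    dot p p <= LF ^+ 2 * dot D2 D2 ->
    dot q q <= LF ^+ 2 * a2 ->
  - tau * dot g W <= K3 LF delta tau / 2 * (a1 + dot D1 D1)
    + K1 delta tau / 2 * dot D3 D3
    + 3 * delta * tau * (tau^-1 + LF) ^+ 2 / 2 * dot D2 D2
    + K4 LF delta tau / 2 * a2.
Proof.
move=> hdot LF0 delta0 tau0 WE hg hp hq.
have s0 : 0 < tau * LF by rewrite mulr_gt0.
have hW : dot W W <= 3 * (tau^-1 ^+ 2 * dot D3 D3)
    + 3 * ((tau^-1 + LF) ^+ 2 * dot D2 D2) + 3 * (LF ^+ 2 * a2).
  rewrite WE; apply: le_trans (dot_add3_le hdot _ _ _) _.
  apply: lerD; [apply: lerD|]; rewrite ler_pM2l//.
  - by rewrite (dotZl hdot) (dotZr hdot) !mulNr mulrN opprK mulrA -expr2.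
  (* With weight [s = tau * LF] the two factors add up to the perfect square
     [(tau^-1 + LF) ^+ 2]. *)
  - apply: le_trans (dot_add_le hdot _ _ s0) _.
    rewrite (dotZl hdot) (dotZr hdot) (dotNl hdot) (dotNr hdot) opprK.
    have s1 : 0 <= 1 + (tau * LF)^-1 by rewrite addr_ge0// invr_ge0 ltW.
    apply: le_trans (lerD (lexx _) (ler_wpM2l s1 hp)) _.
    rewrite le_eqVlt; apply/orP; left; apply/eqP.
    by field; rewrite !gt_eqF.
  - by rewrite (dotNl hdot) (dotNr hdot) opprK.
have := dot_young hdot W (- g) delta0.
rewrite !(dotNl hdot, dotNr hdot) opprK (dotC hdot W g) => hy.
have dV : 0 < delta^-1 by rewrite invr_gt0.
have h1 := ler_wpM2l (ltW dV) hg.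
have h2 := ler_wpM2l (ltW delta0) hW.
have h3 : 2 * - dot g W <= delta * (3 * (tau^-1 ^+ 2 * dot D3 D3)
    + 3 * ((tau^-1 + LF) ^+ 2 * dot D2 D2) + 3 * (LF ^+ 2 * a2))
    + delta^-1 * (LF ^+ 2 * (a1 + dot D1 D1)) by lra.
have t2 : 0 <= tau / 2 by rewrite divr_ge0// ltW.
have := ler_wpM2l t2 h3.
have -> : tau / 2 * (2 * - dot g W) = - tau * dot g W by field.
move=> /le_trans; apply; rewrite le_eqVlt; apply/orP; left; apply/eqP.
by rewrite /K1 /K3 /K4; field; rewrite !gt_eqF.
Qed.

(** * Descent along a trajectory *)

(** Induction step of [sum_dist_bound]: multiplying the Lyapunov decrease by [2 * c / LF] turns
    [LF / 2 * S] into [c * S]. *)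
Lemma sum_dist_arith (R : realFieldType) (LF c e S X Y l0 l1 l2 s : R) :
    0 < LF -> 0 <= c -> l2 <= l1 - LF / 2 * S - (Y - e * X) ->
  2 * c / LF * (l0 - l1) + s + (4 * X + c * S)
  <= 2 * c / LF * (l0 - l2)
     + (s + ((4 + 2 * c / LF * e) * X - 2 * c / LF * Y)).
Proof.
move=> LF0 c0 hl.
have cS : 2 * c / LF * (LF / 2 * S) = c * S by field; rewrite gt_eqF.
have q0 : 0 <= 2 * c / LF by rewrite divr_ge0 ?mulr_ge0// ltW.
have := ler_wpM2l q0 hl; move: cS; set q := 2 * c / LF; lra.
Qed.

(** Scalar core of [dist0_le]: [U], [W] are the new and old squared x-increments, [b2], [b1] those
    of B, [X] the squared noise, [Z] the squared lookahead error and [Y] the squared increment of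
    the B-gradient. *)
Lemma dist_arith (R : realFieldType)
    (L2 ei a ti tau2 U W b1 b2 X Y Z : R) :
    0 <= L2 -> 0 <= tau2 -> 0 <= U -> 0 <= W -> 0 <= b1 -> 0 <= b2 -> a <= 1 ->
    Z <= L2 * W -> Y <= L2 * (U + b1) ->
  2 * (ei ^+ 2 * (2 * (a * W) + 2 * U)) + 2 * (2 * X + 2 * Z)
    + (2 * (L2 * U) + 2 * (ti ^+ 2 * b2)) + (2 * b2 + 2 * (tau2 * Y))
  <= 4 * X + (4 * (ei ^+ 2 + L2) + 2 * L2 + 2 * ti ^+ 2 + 2 + 2 * tau2 * L2)
             * (U + W + b2 + b1).
Proof.
move=> L20 t20 U0 W0 b10 b20 a1 hZ hY.
have hY' := ler_wpM2l t20 hY.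
have ha := ler_wpM2l (sqr_ge0 ei) (ler_wpM2r W0 a1).
have nn c : 0 <= c -> [/\ 0 <= c * U, 0 <= c * W, 0 <= c * b1 & 0 <= c * b2].
  by move=> c0; rewrite !mulr_ge0.
have [? ? ? ?] := nn _ (sqr_ge0 ei); have [? ? ? ?] := nn _ (sqr_ge0 ti).
have [? ? ? ?] := nn _ L20; have [? ? ? ?] := nn _ (mulr_ge0 t20 L20).
lra.
Qed.

(** Scalar core of [lyapunov_step]. The terms [b3] and [V], one index ahead, come from the dual step
    and cancel against the negative [C1] and [C3] terms of Psi. Since [C2] is the midpoint of [K3]
    and [K2 - K1], both B-increments have the same slack [(K2 - K1 - K3) / 4], which [gap] makes at
    least [LF / 2]. For [W] the bound is [LF]: one half is progress, the other pays for the
    lookahead error. *)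
Lemma lyapunov_arith (R : realFieldType)
    (LF ti ei a k1 k3 k4 c4 Q F11 F21 F22 l11 l21 l22 h1 h2 b1 b2 b3
     U V W P X Y Z : R) :
    0 <= U -> 0 <= W -> 0 <= b1 -> 0 <= b2 -> 0 <= ei * a ->
    LF / 2 <= ei * (1 - a / 2) - (2 * LF + k3 + k4) / 2 - c4 / 2 ->
    LF <= c4 / 2 - ei * a / 2 ->
    k1 + k3 + 2 * LF <= 2 * ti - LF - Q ->
    2 * - Y <= LF^-1 * Z + LF * U ->
    2 * P <= W + U ->
    LF^-1 * Z <= LF * W ->
    F22 <= F21 + (- ti * b2 - (l21 - l11)) + LF / 2 * b2 ->
    F21 <= F11 + (ei * (a * P - U) - X - Y) + LF / 2 * U ->
    l22 - l21 - h2 + h1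
      <= k3 / 2 * (U + b1) + k1 / 2 * b3 + Q / 2 * b2 + k4 / 2 * V ->
  F22 + l22 - h2 - k1 / 2 * b3 + 2^-1 * (2 * ti - LF - Q - k1 + k3) / 2 * b2
    - k4 / 2 * V + c4 / 2 * U
  <= F11 + l11 - h1 - k1 / 2 * b2 + 2^-1 * (2 * ti - LF - Q - k1 + k3) / 2 * b1
    - k4 / 2 * U + c4 / 2 * W
    - LF / 2 * (U + W + b2 + b1) - X.
Proof.
move=> U0 W0 b10 b20 ei0 cu cd gap yr yv hr hB hx hd.
have hU := ler_wpM2r U0 cu; have hW := ler_wpM2r W0 cd.
have hb := ler_wpM2r (addr_ge0 b10 b20) gap.
have hP := ler_wpM2l ei0 yv.
lra.
Qed.

(** The pathwise analysis sees the minibatch gradients as an arbitrary sequence [G], and the prox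
    step only through its optimality condition. *)
Record trajectory (R : realType) (X : normedModType R) (ip : {dot X for idfun})
    (n d : nat) (p : problem X n d) (tau e alpha : R) (G : nat -> X)
    (x : nat -> X) (B Lam : nat -> 'M[R]_(n, d)) : Prop := Trajectory {
  traj_x : forall k, (0 < k)%N ->
    x k.+1 = x k + alpha *: (x k - x k.-1) - e *: G k ;
  traj_B : forall k,
    B k.+1 = B k - tau *: (grad_B_F p (x k.+1) (B k) + Lam k) ;
  traj_Lam : forall k, subdifferential (hconj p) (Lam k.+1)
    (2 *: B k.+1 - B k - tau *: (Lam k.+1 - Lam k)) }.

Section Descent.
Context (R : realType) (X : normedModType R) (ip : {dot X for idfun})
  (n d : nat) (p : problem X n d) (LF delta tau nu alpha beta : R).
Hypotheses (hX : finite_dimensional X) (hip : induces_norm ip)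
  (hp : problem_regular p) (LF0 : 0 < LF) (hs : smooth ip p LF).
Hypotheses (delta0 : 0 < delta) (tau0 : 0 < tau)
  (nu01 : 0 < nu < 1) (al0 : 0 < alpha < (1 - nu) / 2) (be0 : 0 < beta < 1)
  (gap : K1 delta tau + K3 LF delta tau + 2 * LF <= K2 LF delta tau).
Local Notation eta := (eta_of LF delta tau nu alpha beta).
Local Notation e := (eta / LF).
Local Notation fdot := (@frob_dot R n d).
Local Notation hfrob := (frob_inner R n d).
Local Notation hipi := (dot_for_inner ip).
Context (G x : nat -> X) (B Lam : nat -> 'M[R]_(n, d)).
Hypothesis hT : trajectory ip p tau e alpha G x B Lam.

Definition lookahead (x : nat -> X) k := x k + beta *: (x k - x k.-1).
Local Notation z := (lookahead x).
Local Notation xi k := (G k - grad_x_F ip p (z k) (B k)) (only parsing).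
Local Notation gx k := (grad_x_F ip p (x k) (B k)) (only parsing).
Local Notation gB k := (grad_B_F p (x k.+1) (B k)) (only parsing).
Local Notation dx k := (x k - x k.-1) (only parsing).
Local Notation dB k := (B k - B k.-1) (only parsing).

Definition progress (x : nat -> X) (B : nat -> 'M[R]_(n, d)) k :=
  ip (x k.+1 - x k) (x k.+1 - x k) + ip (x k - x k.-1) (x k - x k.-1)
  + fdot (B k.+1 - B k) (B k.+1 - B k) + fdot (B k - B k.-1) (B k - B k.-1).

(** Real-valued form of [Psi_sgdm]. From index 1 on [fine] loses nothing, because the prox step
    makes the conjugate finite there. *)
Definition lyapunov (x : nat -> X) (B Lam : nat -> 'M[R]_(n, d)) k :=
  F p (x k) (B k) + fdot (B k) (Lam k) - fine (hconj p (Lam k))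
  - C1 delta tau / 2 * fdot (B k.+1 - B k) (B k.+1 - B k)
  + C2 LF delta tau / 2 * fdot (B k - B k.-1) (B k - B k.-1)
  - C3 LF delta tau / 2 * ip (x k.+1 - x k) (x k.+1 - x k)
  + C4 LF delta tau nu alpha beta / 2 * ip (x k - x k.-1) (x k - x k.-1).

Lemma hconj_traj_fin k : hconj p (Lam k.+1) \is a fin_num.
Proof. exact: (traj_Lam hT k).1. Qed.

Lemma Psi_sgdmE k :
  Psi_sgdm p LF delta tau nu alpha beta x B Lam k.+1
  = (lyapunov x B Lam k.+1)%:E.
Proof.
rewrite /Psi_sgdm /lagrangian -(fineK (hconj_traj_fin k)) -EFinN -!EFinD /=.
rewrite /lyapunov /= !frob_normE -!hip; congr EFin.
set a := C1 _ _; set b := C2 _ _ _; set c := C3 _ _ _; set c4 := C4 _ _ _ _ _ _.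
by ring.
Qed.

Lemma dB_eq k : B k.+1 - B k = - tau *: (gB k + Lam k).
Proof. by rewrite (traj_B hT) addrC addKr scaleNr. Qed.

Lemma dB_solve k : Lam k = - tau^-1 *: (B k.+1 - B k) - gB k.
Proof.
rewrite dB_eq scalerA mulrNN mulVf ?gt_eqF// scale1r.
by rewrite addrAC subrr add0r.
Qed.

(** Two consecutive B-steps eliminate the dual variables, leaving only a B-increment and a gradient
    increment. *)
Lemma subgradient_gap k :
  B k.+1 - (2 *: B k.+1 - B k - tau *: (Lam k.+1 - Lam k))
    = - (B k.+2 - B k.+1) - tau *: (gB k.+1 - gB k).
Proof.
have := dB_eq k.+1; have := dB_eq k => /=.
move: (grad_B_F p _ (B k.+1)) (grad_B_F p _ (B k)) => g1 g0.
move: (B k.+2) (B k.+1) (B k) (Lam k) (Lam k.+1).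
move=> B2 B1 B0 L0 L1 /matrixP h0 /matrixP h1.
apply/matrixP => i j; have := h0 i j; have := h1 i j.
rewrite !mxE; lra.
Qed.

Lemma gB_diff k : fdot (gB k.+1 - gB k) (gB k.+1 - gB k)
  <= LF ^+ 2 * (ip (dx k.+2) (dx k.+2) + fdot (dB k.+1) (dB k.+1)).
Proof. exact: smooth_B. Qed.

(** The subgradient [v] at [Lam k.+1] reduces the left side to the product of [B k.+2 - v] with the
    dual increment. By [subgradient_gap] the first factor is [- tau] times a gradient increment, and
    [dual_step] applies. *)
Lemma lagrangian_dual_step k :
  fdot (B k.+2) (Lam k.+2 - Lam k.+1)
    - fine (hconj p (Lam k.+2)) + fine (hconj p (Lam k.+1))
  <= K3 LF delta tau / 2 * (ip (dx k.+2) (dx k.+2) + fdot (dB k.+1) (dB k.+1))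
    + K1 delta tau / 2 * fdot (dB k.+3) (dB k.+3)
    + 3 * delta * tau * (tau^-1 + LF) ^+ 2 / 2 * fdot (dB k.+2) (dB k.+2)
    + K4 LF delta tau / 2 * ip (dx k.+3) (dx k.+3).
Proof.
have [f1 /(_ (Lam k.+2))] := traj_Lam hT k.
have f2 := hconj_traj_fin k.+1.
rewrite -{1}(fineK f1) -{1}(fineK f2) -EFinD lee_fin => hsub.
have hg := subgradient_gap k.
have gB' := gB_diff k.
have hWp := smooth_B hip hs (x k.+3) (x k.+3) (B k.+2) (B k.+1).
have hWq := smooth_B hip hs (x k.+3) (x k.+2) (B k.+1) (B k.+1).
rewrite (subrr (x _)) (dot0l hipi 0) add0r in hWp.
rewrite (subrr (B _)) (dot0l hfrob 0) addr0 in hWq.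
(* The gradient change is split at the intermediate point [(x k.+3, B k.+1)], separating the effect
   of B from that of x. *)
have WE : Lam k.+2 - Lam k.+1 = - tau^-1 *: (B k.+3 - B k.+2)
    + (tau^-1 *: (B k.+2 - B k.+1)
       - (grad_B_F p (x k.+3) (B k.+2) - grad_B_F p (x k.+3) (B k.+1)))
    - (grad_B_F p (x k.+3) (B k.+1) - grad_B_F p (x k.+2) (B k.+1)).
  rewrite (dB_solve k.+2) (dB_solve k.+1) /=.
  move: (grad_B_F _ _ _) (grad_B_F _ _ _) (grad_B_F _ _ _) => g2 g1 g0.
  by apply/matrixP => i j; rewrite !mxE; ring.
apply: le_trans (dual_step hfrob LF0 delta0 tau0 WE gB' hWp hWq).
set v := 2 *: _ - _ - _ in hsub hg.
have -> : - tau * fdot (gB k.+1 - gB k) (Lam k.+2 - Lam k.+1)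
   = fdot (B k.+1 - v) (Lam k.+2 - Lam k.+1)
     + fdot (B k.+2 - B k.+1) (Lam k.+2 - Lam k.+1).
  rewrite hg -(dotDl hfrob) -(dotZl hfrob); congr (fdot _ _).
  move: (B k.+2 - B k.+1) (gB k.+1 - gB k) => a c.
  by rewrite scaleNr addrAC addNr add0r.
rewrite (dotDl hfrob (B k.+1)) (dotDl hfrob (B k.+2)) !(dotNl hfrob).
move: hsub; move: (fdot v _) (fdot (B k.+2) _) (fdot (B k.+1) _).
move: (fine _) (fine _) => h1 h2 a b c; rewrite -subr_ge0 => H.
by rewrite -subr_ge0; congr (is_true (0 <= _)): H; ring.
Qed.

Lemma step_gt0 : 0 < e.
Proof.
by have [eta0 _ _] := step_coefficients LF0 delta0 tau0 nu01 al0 be0;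
  rewrite divr_gt0.
Qed.

Lemma lookahead_gap k :
  ip (grad_x_F ip p (z k.+1) (B k.+1) - gx k.+1)
     (grad_x_F ip p (z k.+1) (B k.+1) - gx k.+1)
  <= LF ^+ 2 * ip (x k.+1 - x k) (x k.+1 - x k).
Proof.
apply: le_trans (smooth_x hip hs (z k.+1) (x k.+1) (B k.+1)) _.
have -> : z k.+1 - x k.+1 = beta *: (x k.+1 - x k).
  by rewrite /lookahead addrC addKr.
rewrite (dotZl hipi) (dotZr hipi) ler_pM2l ?exprn_gt0// mulrA.
rewrite -[leRHS]mul1r ler_wpM2r ?(dot_ge0 hipi)// mulr_ile1//;
by case/andP: be0 => ? ?; exact: ltW.
Qed.

(** The x-step solved for [G], from which the noise and the lookahead error are subtracted. *)
Lemma grad_x_iterate k :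
  gx k.+1 = e^-1 *: (alpha *: (x k.+1 - x k) - (x k.+2 - x k.+1))
    - xi k.+1 - (grad_x_F ip p (z k.+1) (B k.+1) - gx k.+1).
Proof.
have <- : G k.+1 = e^-1 *: (alpha *: (x k.+1 - x k) - (x k.+2 - x k.+1)).
  rewrite (traj_x hT (ltn0Sn k)) /=.
  rewrite -[x k.+1 + _ - _]addrA [x k.+1 + _ - x k.+1]addrC addKr.
  rewrite opprB addrCA subrr addr0 scalerA mulVf ?scale1r//.
  by rewrite gt_eqF// step_gt0.
by rewrite /= opprB [G k.+1 + _]addrC subrK opprB addrC subrK.
Qed.

Lemma lyapunov_step k : lyapunov x B Lam k.+2 <= lyapunov x B Lam k.+1
  - LF / 2 * progress x B k.+1 - ip (xi k.+1) (x k.+2 - x k.+1).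
Proof.
have [eta0 cu cd] := step_coefficients LF0 delta0 tau0 nu01 al0 be0.
have e0 := step_gt0.
have ei0 : 0 <= e^-1 * alpha.
  by rewrite mulr_ge0 ?invr_ge0 ?(ltW e0)//; case/andP: al0 => /ltW.
have hgB : grad_B_F p (x k.+2) (B k.+1)
    = - tau^-1 *: (B k.+2 - B k.+1) - Lam k.+1.
  by rewrite (dB_solve k.+1) opprB addrC subrK.
have hz := lookahead_gap k; have gE := grad_x_iterate k.
have := lagrangian_dual_step k => /=.
have := descent_x hX hip hp LF0 hs (x k.+1) (x k.+2) (B k.+1).
have := descent_B hip LF0 hs (x k.+2) (B k.+1) (B k.+2).
rewrite hgB [in X in _ -> X -> _]gE.
move: (xi k.+1) hz.
move: (grad_x_F _ _ _ _ - _).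
rewrite /lyapunov /progress /=.
move: (x k.+2 - x k.+1) (x k.+1 - x k) => u v r xi hr.
rewrite !(dotDl hfrob (_ *: _)) (dotZl hfrob) (dotNl hfrob).
rewrite (dotDr hfrob (Lam k.+1)) (dotNr hfrob (Lam k.+1)).
rewrite (dotDr hfrob (B k.+2)) (dotNr hfrob (B k.+2)).
rewrite !(dotC hfrob (Lam k.+1)).
rewrite (dotDl hipi) (dotNl hipi) (dotDl hipi) (dotNl hipi).
rewrite (dotZl hipi) (dotDl hipi) (dotNl hipi) (dotZl hipi) => hB hx hd.
have LFV : 0 < LF^-1 by rewrite invr_gt0.
(* The lookahead error [r] has norm at most [LF] times that of [v], so weight [LF^-1] makes both
   resulting terms cost [LF]. *)
have yr := dot_young hipi (- r) u LFV.
rewrite invrK !(dotNl hipi) (dotNr hipi) opprK in yr.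
have yv := dot_young hipi v u ltr01; rewrite invr1 !mul1r in yv.
have {}hr : LF^-1 * ip r r <= LF * ip v v.
  by rewrite ler_pdivrMl// mulrA -expr2.
have eE : LF / eta = e^-1 by rewrite (invf_div eta LF).
rewrite eE in cu cd.
exact: (lyapunov_arith (dot_ge0 hipi _) (dot_ge0 hipi _) (dot_ge0 hfrob _)
  (dot_ge0 hfrob _) ei0 cu cd gap yr yv hr hB hx hd).
Qed.

Definition dist_const :=
  4 * (e^-1 ^+ 2 + LF ^+ 2) + 2 * LF ^+ 2 + 2 * tau^-1 ^+ 2 + 2
  + 2 * tau ^+ 2 * LF ^+ 2.

(** The infimum is bounded by one explicit element, built from the subgradient [v] that the prox
    step supplies. Each of its three blocks is then rewritten through increments and noise. *)
Lemma dist0_le k :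
  (dist0 (lagrangian_subdiff ip p (x k.+1) (B k.+1) (Lam k.+1)) ^+ 2
   <= (4 * ip (xi k.+1) (xi k.+1) + dist_const * progress x B k.+1)%:E)%E.
Proof.
set v := 2 *: B k.+1 - B k - tau *: (Lam k.+1 - Lam k).
have hv : subdifferential (hconj p) (Lam k.+1) v by exact: (traj_Lam hT k).
set S := lagrangian_subdiff _ _ _ _ _.
pose D := `|gx k.+1| ^+ 2
  + frob_norm (grad_B_F p (x k.+1) (B k.+1) + Lam k.+1) ^+ 2
  + frob_norm (B k.+1 - v) ^+ 2.
have D0 : 0 <= D by rewrite !addr_ge0 ?sqr_ge0.
have hS : (dist0 S <= (Num.sqrt D)%:E)%E.
  apply: ereal_inf_lbound.
  exists (gx k.+1, grad_B_F p (x k.+1) (B k.+1) + Lam k.+1, B k.+1 - v) => //.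
  by split=> //; exists v.
have S0 : (0 <= dist0 S)%E.
  by apply: le_ereal_inf_tmp => _ [w _ <-]; rewrite lee_fin sqrtr_ge0.
have {}hS : (dist0 S ^+ 2 <= D%:E)%E.
  by rewrite -(sqr_sqrtr D0) expe2 expr2 EFinM lee_pmul.
apply: (le_trans hS); rewrite lee_fin /D !frob_normE -hip.
have hz := lookahead_gap k; have gE := grad_x_iterate k.
have hb3 : fdot (B k.+1 - v) (B k.+1 - v)
    <= 2 * fdot (B k.+2 - B k.+1) (B k.+2 - B k.+1)
     + 2 * (tau ^+ 2 * fdot (gB k.+1 - gB k) (gB k.+1 - gB k)).
  rewrite subgradient_gap; apply: le_trans (dot_add2_le hfrob _ _) _.
  by rewrite !(dotNl hfrob, dotNr hfrob, dotZl hfrob, dotZr hfrob) !opprK mulrA.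
have hb2 : fdot (grad_B_F p (x k.+1) (B k.+1) + Lam k.+1)
      (grad_B_F p (x k.+1) (B k.+1) + Lam k.+1)
    <= 2 * (LF ^+ 2 * ip (x k.+2 - x k.+1) (x k.+2 - x k.+1))
      + 2 * (tau^-1 ^+ 2 * fdot (B k.+2 - B k.+1) (B k.+2 - B k.+1)).
  rewrite (dB_solve k.+1) addrCA.
  apply: le_trans (dot_add2_le hfrob _ _) _; rewrite [leRHS]addrC.
  apply: lerD; rewrite ler_pM2l//.
    by rewrite (dotZl hfrob) (dotZr hfrob) mulrA mulrNN -expr2.
  have := smooth_B hip hs (x k.+1) (x k.+2) (B k.+1) (B k.+1).
  rewrite (subrr (B _)) (dot0l hfrob 0) addr0.
  by rewrite -[x k.+1 - x k.+2]opprB (dotNl hipi) (dotNr hipi) opprK.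
have hb1 : ip (gx k.+1) (gx k.+1)
    <= 2 * (e^-1 ^+ 2 * (2 * (alpha ^+ 2 * ip (x k.+1 - x k) (x k.+1 - x k))
                         + 2 * ip (x k.+2 - x k.+1) (x k.+2 - x k.+1)))
     + 2 * (2 * ip (xi k.+1) (xi k.+1)
            + 2 * ip (grad_x_F ip p (z k.+1) (B k.+1) - gx k.+1)
                     (grad_x_F ip p (z k.+1) (B k.+1) - gx k.+1)).
  rewrite [in X in X <= _]gE -addrA -opprD.
  move: (xi _) (grad_x_F _ _ _ _ - _) => u w {hz gE}.
  apply: le_trans (dot_add2_le hipi _ _) _.
  rewrite (dotNl hipi) (dotNr hipi) opprK.
  apply: lerD; rewrite ler_pM2l//; last exact: (dot_add2_le hipi).
  rewrite (dotZl hipi) (dotZr hipi) mulrA -expr2 ler_pM2l; last first.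
    by rewrite exprn_gt0// invr_gt0 step_gt0.
  apply: le_trans (dot_add2_le hipi _ _) _.
  rewrite (dotNl hipi) (dotNr hipi) opprK (dotZl hipi) (dotZr hipi).
  by rewrite mulrA -expr2.
have al1 : alpha ^+ 2 <= 1.
  case/andP: al0 => a0 a1; case/andP: nu01 => n0 n1.
  apply: exprn_ile1; first exact: ltW.
  apply/ltW/(lt_trans a1); rewrite ltr_pdivrMr// mul1r ltrBlDl.
  by rewrite ltr_wpDl ?(ltW n0)// ltr1n.
have hgB := gB_diff k => /=.
apply: le_trans (lerD (lerD hb1 hb2) hb3) _.
exact: (dist_arith e^-1 tau^-1 (ip (xi k.+1) (xi k.+1)) (sqr_ge0 LF)
  (sqr_ge0 tau) (dot_ge0 hipi _) (dot_ge0 hipi _) (dot_ge0 hfrob _)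
  (dot_ge0 hfrob _) al1 hz hgB).
Qed.

(** The increment [x k.+2 - x k.+1] without its noise part. It depends on the past only, so its
    product with the noise has mean zero. *)
Definition drift k :=
  alpha *: (x k.+1 - x k) - e *: grad_x_F ip p (z k.+1) (B k.+1).

Lemma sum_dist_bound N :
  \sum_(k < N) (4 * ip (xi k.+1) (xi k.+1) + dist_const * progress x B k.+1)
  <= 2 * dist_const / LF * (lyapunov x B Lam 1 - lyapunov x B Lam N.+1)
     + \sum_(k < N) ((4 + 2 * dist_const / LF * e) * ip (xi k.+1) (xi k.+1)
                     - 2 * dist_const / LF * ip (xi k.+1) (drift k)).
Proof.
elim: N => [|N IH]; first by rewrite !big_ord0 subrr mulr0 addr0.
rewrite !big_ord_recr /=; apply: le_trans (lerD IH (lexx _)) _.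
have hl := lyapunov_step N.
have uE : x N.+2 - x N.+1 = drift N - e *: xi N.+1.
  rewrite (traj_x hT (ltn0Sn N)) /drift /=.
  move: (grad_x_F _ _ _ _) (G N.+1) (x N.+1 - x N) => g g' v.
  move: (x N.+1) => y.
  rewrite scalerBr opprB [RHS]addrA subrK.
  by rewrite -addrA [- _ - _]addrC addrA [y + _]addrC addrK.
have c0 : 0 <= dist_const.
  by do ?[exact: ler0n | exact: sqr_ge0 | apply: addr_ge0 | apply: mulr_ge0].
rewrite uE (dotDr hipi) (dotNr hipi) (dotZr hipi) in hl.
exact: (sum_dist_arith _ _ LF0 c0 hl).
Qed.

End Descent.

(** * Sampling without replacement *)

(** Complementation maps these sets to the subsets of [~: C] with [#|T| - b] elements. Counted this
    way the formula is also right for [b < #|C|], where truncated subtraction would spoil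
    [b - #|C|]. *)
Lemma card_draws_superset (T : finType) (C : {set T}) (b : nat) :
    (b <= #|T|)%N ->
  #|[set S : {set T} | (C \subset S) && (#|S| == b)]%SET|
    = 'C(#|T| - #|C|, #|T| - b).
Proof.
move=> bT; have -> : (#|T| - #|C|)%N = #|~: C|.
  by rewrite [RHS]cardsCs finset.setCK.
rewrite -cards_draws -(card_preimset _ (can_inj (@finset.setCK T))).
apply: eq_card => S; rewrite !inE finset.subsetC; congr (_ && _).
rewrite [#|~: S|]cardsCs finset.setCK; have := max_card (mem S) => ST.
by rewrite -[LHS](eqn_add2r #|S|) -[RHS](eqn_add2r b) !subnK// eq_sym addnC.
Qed.

Section BatchVariance.
Context (R : realType) (V : lmodType R) (dot : V -> V -> R).
Hypothesis hdot : inner_product dot.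
Context (n b : nat) (v : 'I_n -> V) (s : R).
Hypotheses (b0 : (0 < b)%N) (bn : (b <= n)%N).
Hypotheses (v0 : \sum_i v i = 0) (vs : n%:R^-1 * \sum_i dot (v i) (v i) <= s).
(* The numbers of b-subsets of 'I_n containing one, respectively two, given
   points, obtained by counting complements. *)
Let N1 := 'C(n.-1, n - b).
Let N2 := 'C(n - 2, n - b).

Lemma sum_draws : \sum_(S : {set 'I_n} | #|S| == b) \sum_(i in S) v i = 0.
Proof.
rewrite (exchange_big_dep predT)//=.
transitivity (\sum_i v i *+ N1); last by rewrite sumrMnl v0 mul0rn.
apply: eq_bigr => i _; rewrite sumr_const; congr (_ *+ _).
rewrite /N1 -subn1 -(cards1 i).
rewrite -[X in 'C(X - _, _)]card_ord -[X in 'C(_, X - _)]card_ord.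
rewrite -card_draws_superset ?card_ord//; apply: eq_card => S.
by rewrite !inE finset.sub1set andbC.
Qed.

(** Every pair contributes with weight [N2], and that part vanishes because the [v i] sum to 0. Only
    the diagonal excess [N1 - N2] is left. *)
Lemma sum_draws_sqr :
  \sum_(S : {set 'I_n} | #|S| == b)
    dot (\sum_(i in S) v i) (\sum_(i in S) v i)
  <= N1%:R * \sum_i dot (v i) (v i).
Proof.
under eq_bigr => S _.
  rewrite (dot_suml hdot); under eq_bigr do rewrite (dot_sumr hdot).
  over.
rewrite (exchange_big_dep predT)//=.
under eq_bigr => i _.
  rewrite (exchange_big_dep predT)//=.
  over.
have E i j : \sum_(S : {set 'I_n} | (#|S| == b) && (i \in S) && (j \in S))
      dot (v i) (v j)
    = N2%:R * dot (v i) (v j)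
      + (if j == i then (N1%:R - N2%:R) * dot (v i) (v j) else 0).
  rewrite sumr_const -[LHS]mulr_natl.
  have -> : #|[pred S : {set 'I_n} | (#|S| == b) && (i \in S) && (j \in S)]|
      = 'C(n - #|[set i; j]%SET|, n - b).
    rewrite -[X in 'C(X - _, _)]card_ord -[X in 'C(_, X - _)]card_ord.
    rewrite -card_draws_superset ?card_ord//; apply: eq_card => S.
    by rewrite !inE finset.subUset !finset.sub1set -andbA andbC.
  rewrite cards2; have [->|ji] := eqVneq j i.
    by rewrite /= subn1 -mulrDl addrC subrK.
  by rewrite addr0.
under eq_bigr => i _.
  under eq_bigr => j _ do rewrite E.
  rewrite big_split /= -big_mkcond big_pred1_eq -mulr_sumr -(dot_sumr hdot) v0.
  rewrite (dot0r hdot) mulr0 add0r.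
  over.
rewrite /= -mulr_sumr ler_wpM2r//.
  by apply: sumr_ge0 => i _; exact: dot_ge0.
by rewrite lerBlDr lerDl.
Qed.

Lemma bin_pred_mul : ('C(n, b) * b = n * N1)%N.
Proof.
rewrite /N1; case: n bn => [|m] bm; first by move: bm b0; case: b.
by case: b b0 bm => [//|c] _ cm; rewrite subSS bin_sub// mulnC -mul_bin_diag.
Qed.

(** The linear term averages to 0 since the batch mean is unbiased. In the quadratic one the factors
    combine to [1 / (n * b)] by [bin_pred_mul]. *)
Lemma batch_moments (A q : R) (a : V) : 0 <= A ->
  \sum_(S : {set 'I_n} | #|S| == b) 'C(n, b)%:R^-1 *
    (A * dot (b%:R^-1 *: \sum_(i in S) v i) (b%:R^-1 *: \sum_(i in S) v i)
     - q * dot (b%:R^-1 *: \sum_(i in S) v i) a)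
  <= A * (s / b%:R).
Proof.
move=> A0; rewrite -mulr_sumr sumrB -!mulr_sumr -(dot_suml hdot) -scaler_sumr.
rewrite sum_draws scaler0 (dot0l hdot) mulr0 subr0 mulrCA ler_wpM2l//.
under eq_bigr do rewrite (dotZl hdot) (dotZr hdot) mulrA.
rewrite -mulr_sumr.
have Cn0 : 0 < 'C(n, b)%:R :> R by rewrite ltr0n bin_gt0.
have bR : 0 < b%:R :> R by rewrite ltr0n.
have nR : 0 < n%:R :> R by rewrite ltr0n (leq_trans b0).
have Cb : 'C(n, b)%:R * b%:R = n%:R * N1%:R :> R.
  by rewrite -!natrM bin_pred_mul.
have N1E : N1%:R = 'C(n, b)%:R * b%:R / n%:R :> R.
  by rewrite Cb mulrAC divff ?gt_eqF// mul1r.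
have bb0 : 0 <= b%:R^-1 * b%:R^-1 :> R by rewrite mulr_ge0// invr_ge0 ltW.
have Ci0 : 0 <= 'C(n, b)%:R^-1 :> R by rewrite invr_ge0 ltW.
apply: le_trans (ler_wpM2l Ci0 (ler_wpM2l bb0 sum_draws_sqr)) _.
rewrite N1E; have := vs; set W := \sum_i _ => Ws.
have -> : 'C(n, b)%:R^-1 * (b%:R^-1 * b%:R^-1 * ('C(n, b)%:R * b%:R / n%:R * W))
    = (n%:R^-1 * W) / b%:R by field; rewrite !gt_eqF.
by rewrite ler_pM2r ?invr_gt0.
Qed.

End BatchVariance.

(** * Random variables with finitely many values *)

(** Stands in for measurability with respect to the sigma-algebra generated by [Y]. *)
Definition determined (Omega S U : Type) (Y : Omega -> S) (f : Omega -> U) :=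
  forall w w', Y w = Y w' -> f w = f w'.

Section FiniteRange.
Context (disp : measure_display) (Omega : measurableType disp) (R : realType)
  (P : probability Omega R).

Definition prob_eq (S : Type) (Y : Omega -> S) (s : S) : R :=
  fine (P (Y @^-1` [set s])).

Lemma prob_eq_ge0 (S : Type) (Y : Omega -> S) (s : S) : 0 <= prob_eq Y s.
Proof. exact: fine_ge0. Qed.

Lemma determined_factor (S : Type) (Y : Omega -> S) (f : Omega -> R) :
  determined Y f -> exists phi : S -> R, forall w, f w = phi (Y w).
Proof.
move=> hf; exists (fun s => xget 0 [set r | exists2 w, Y w = s & f w = r]) => w.
case: xgetP => [r _ [w' Yw' <-]|/(_ (f w)) []]; first exact: hf.
by exists w.
Qed.

Section OneVariable.
Context (S : finType) (Y : Omega -> S).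
Hypothesis mY : forall s, measurable (Y @^-1` [set s]).

Lemma finite_range_sum (phi : S -> R) w :
  phi (Y w) = \sum_s phi s * \1_(Y @^-1` [set s]) w.
Proof.
rewrite (bigD1 (Y w))//= indicE mem_set// mulr1 big1 ?addr0// => s sY.
by rewrite indicE memNset ?mulr0//= => /esym/eqP; exact/negP.
Qed.

Lemma determined_integrable (f : Omega -> R) :
  determined Y f -> P.-integrable setT (EFin \o f).
Proof.
move=> /determined_factor[phi fE].
have -> : EFin \o f =
    (fun w => \sum_s ((phi s)%:E * (\1_(Y @^-1` [set s]) w)%:E)%E).
  apply/funext => w; rewrite /= fE finite_range_sum -sumEFin.
  by apply: eq_bigr => s _; rewrite EFinM.
apply: integrable_sum => // s _; apply: integrableZl => //.
exact: integrable_indic.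
Qed.

Lemma Rintegral_finite_range (phi : S -> R) :
  \int[P]_w phi (Y w) = \sum_s phi s * prob_eq Y s.
Proof.
rewrite /Rintegral; transitivity (fine (\sum_s (phi s * prob_eq Y s)%:E)%E).
  congr fine; transitivity (\int[P]_w
      \sum_s ((phi s)%:E * (\1_(Y @^-1` [set s]) w)%:E))%E.
    apply: eq_integral => w _; rewrite finite_range_sum -sumEFin.
    by apply: eq_bigr => s _; rewrite EFinM.
  have hi s : P.-integrable setT (fun w => (\1_(Y @^-1` [set s]) w)%:E).
    exact: integrable_indic.
  rewrite integral_sum//; last by move=> s; apply: integrableZl.
  apply: eq_bigr => s _; rewrite integralZl// integral_indic// setIT EFinM.
  by rewrite /prob_eq fineK// fin_num_measure.
by rewrite sumEFin.
Qed.

Lemma sum_prob_eq : \sum_s prob_eq Y s = 1.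
Proof.
have := Rintegral_finite_range (fun=> 1).
under [X in _ = X -> _]eq_bigr do rewrite mul1r.
by move=> <-; rewrite Rintegral_cst// mul1r [X in fine X](probability_setT P).
Qed.

(** A fibre of [Y] on which the value is below [c] lies in a null set, so it carries no weight in
    the finite sum. *)
Lemma ae_Rintegral_ge (f : Omega -> R) (c : R) :
  determined Y f -> {ae P, forall w, c <= f w} -> c <= \int[P]_w f w.
Proof.
move=> /determined_factor[phi fE] hc; rewrite (funext fE).
rewrite Rintegral_finite_range -[c]mulr1 -sum_prob_eq mulr_sumr.
apply: ler_sum => s _; have [sc|sc] := leP c (phi s).
  by rewrite ler_wpM2r// prob_eq_ge0.
suff -> : prob_eq Y s = 0 by rewrite !mulr0.
have [A [mA A0 hA]] := hc.
rewrite /prob_eq; suff -> : P (Y @^-1` [set s]) = 0%E by [].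
apply: (subset_measure0 (mY s) mA) => // w /= ws; apply: hA => /=.
by rewrite fE ws; apply/negP; rewrite -ltNge.
Qed.

Lemma determined_sum (I : Type) (r : seq I) (Q : pred I)
    (f : I -> Omega -> R) :
  (forall i, Q i -> determined Y (f i)) ->
  determined Y (fun w => \sum_(i <- r | Q i) f i w).
Proof. by move=> hf w w' ww'; apply: eq_bigr => i Qi; exact: hf. Qed.

Lemma Rintegral_sum (m : nat) (f : 'I_m -> Omega -> R) :
    (forall i, determined Y (f i)) ->
  \int[P]_w (\sum_i f i w) = \sum_i \int[P]_w f i w.
Proof.
elim: m f => [|m IH] f hf.
  under eq_Rintegral do rewrite big_ord0.
  by rewrite big_ord0 Rintegral_cst// mul0r.
under eq_Rintegral do rewrite big_ord_recr.
rewrite RintegralD//; last 2 first.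
- by apply: determined_integrable; exact: determined_sum.
- exact: determined_integrable.
by rewrite big_ord_recr/= IH.
Qed.

End OneVariable.

(* This plays the role of conditioning on Y: the independent Z is averaged out
   with Y frozen. *)
Lemma freezing (S U : finType) (Y : Omega -> S) (Z : Omega -> U)
    (Phi : Omega -> U -> R) :
    (forall s, measurable (Y @^-1` [set s])) ->
    (forall t, measurable (Z @^-1` [set t])) ->
    (forall s t, P (Y @^-1` [set s] `&` Z @^-1` [set t])
       = (P (Y @^-1` [set s]) * P (Z @^-1` [set t]))%E) ->
    (forall t, determined Y (Phi^~ t)) ->
  \int[P]_w Phi w (Z w) = \int[P]_w (\sum_t prob_eq Z t * Phi w t).
Proof.
move=> mY mZ indep hPhi.
have /choice[phi phiE] : forall t, exists phi : S -> R,
    forall w, Phi w t = phi (Y w) by move=> t; exact: determined_factor.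
pose YZ w := (Y w, Z w).
have YZE s t : YZ @^-1` [set (s, t)] = Y @^-1` [set s] `&` Z @^-1` [set t].
  apply/seteqP; split=> w [Yw Zw]; first by split.
  by rewrite /preimage/= /YZ Yw Zw.
have mYZ u : measurable (YZ @^-1` [set u]).
  by case: u => s t; rewrite YZE; exact: measurableI.
transitivity (\sum_u phi u.2 u.1 * prob_eq YZ u).
  rewrite -(Rintegral_finite_range mYZ (fun u => phi u.2 u.1)).
  by apply: eq_Rintegral => w _ /=; rewrite phiE.
transitivity (\sum_s (\sum_t prob_eq Z t * phi t s) * prob_eq Y s); last first.
  rewrite -(Rintegral_finite_range mY (fun s => \sum_t prob_eq Z t * phi t s)).
  by apply: eq_Rintegral => w _ /=; apply: eq_bigr => t _; rewrite phiE.
rewrite (eq_bigr (fun u => phi u.2 u.1 * prob_eq YZ (u.1, u.2))); last by case.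
rewrite -(pair_bigA _ (fun s t => phi t s * prob_eq YZ (s, t)))/=.
apply: eq_bigr => s _; rewrite mulr_suml; apply: eq_bigr => t _.
rewrite /prob_eq YZE indep fineM ?fin_num_measure//; ring.
Qed.

End FiniteRange.

(** * Histories of minibatches *)

Section Sampling.
Context (disp : measure_display) (Omega : measurableType disp) (R : realType)
  (P : probability Omega R) (n b T : nat) (rho : Omega -> nat)
  (Jk : nat -> Omega -> {set 'I_n}).
Hypotheses (hJ : uniform_minibatches P (fun=> b) Jk)
  (hrho : uniform_index P T rho) (hfresh : fresh_samples P rho Jk).

(** The batches of iterations 1 to [m] as one variable with values in a finite type; hence the shift
    [i.+1]. *)
Definition history (m : nat) (w : Omega) : {ffun 'I_m -> {set 'I_n}} :=
  [ffun i : 'I_m => Jk i.+1 w].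

(** A finite-type copy of [rho]; [inord] is faithful because [rho w <= T.+1]. *)
Definition index_ord (w : Omega) : 'I_T.+2 := inord (rho w).

Lemma historyP m w w' : history m w = history m w' ->
  forall k, (0 < k <= m)%N -> Jk k w = Jk k w'.
Proof.
move=> /ffunP hw [//|k] /= km.
by have := hw (Ordinal km); rewrite !ffunE.
Qed.

Lemma measurable_batch k S : measurable (Jk k.+1 @^-1` [set S]).
Proof.
have [hb hS] := hJ (ltn0Sn k).
have [Sb|Sb] := eqVneq #|S| b; first exact: (hS S Sb).1.
suff -> : Jk k.+1 @^-1` [set S] = set0 by exact: measurable0.
by apply/seteqP; split=> w //= wS; move: Sb; rewrite -wS hb eqxx.
Qed.

Lemma prob_batch k S :
  prob_eq P (Jk k.+1) S = if #|S| == b then 'C(n, b)%:R^-1 else 0.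
Proof.
have [hb hS] := hJ (ltn0Sn k); rewrite /prob_eq.
case: eqVneq => Sb; first by rewrite (hS S Sb).2.
suff -> : Jk k.+1 @^-1` [set S] = set0 by rewrite measure0.
by apply/seteqP; split=> w //= wS; move: Sb; rewrite -wS hb eqxx.
Qed.

Lemma history_preimage m h : history m @^-1` [set h] =
  \bigcap_(i in [set: 'I_m]) (Jk i.+1 @^-1` [set h i]).
Proof.
apply/seteqP; split=> [w /= <- i _|w hw] /=; first by rewrite ffunE.
by apply/ffunP => i; rewrite ffunE; exact: hw.
Qed.

Lemma measurable_history m h : measurable (history m @^-1` [set h]).
Proof.
rewrite history_preimage; apply: fin_bigcap_measurable => //.
by move=> i _; exact: measurable_batch.
Qed.

Lemma index_preimage (r : 'I_T.+2) :
  index_ord @^-1` [set r] = [set w | rho w = r].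
Proof.
apply/seteqP; split=> w /= => [<-|wr]; last first.
  by apply: val_inj; rewrite /= inordK wr.
by rewrite inordK//; have /andP[] := hrho.1 w.
Qed.

Lemma measurable_index r : measurable (index_ord @^-1` [set r]).
Proof.
rewrite index_preimage; have [r2|r2] := boolP (2 <= r <= T.+1)%N.
  exact: (hrho.2 r r2).1.
suff -> : [set w | rho w = r] = set0 by exact: measurable0.
by apply/seteqP; split=> w //= wr; move: r2; rewrite -wr hrho.1.
Qed.

Lemma prob_index r :
  prob_eq P index_ord r = if (2 <= r)%N then T%:R^-1 else 0.
Proof.
rewrite /prob_eq index_preimage; have [r2|r2] := boolP (2 <= r)%N.
  by rewrite (hrho.2 r _).2// r2 -ltnS ltn_ord.
suff -> : [set w | rho w = r] = set0 by rewrite measure0.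
apply/seteqP; split=> w //= wr; move: r2; rewrite -wr.
by have /andP[->] := hrho.1 w.
Qed.

(* k = 0 stands for rho. *)
Lemma history_indep (k : nat) (A : set Omega) m h :
    (k == 0)%N || (m < k)%N ->
    (if k is 0%N then events_of rho else events_of (Jk k)) A ->
  P (history m @^-1` [set h] `&` A) = (P (history m @^-1` [set h]) * P A)%E.
Proof.
move=> km kA.
(* The event at index [i] is [A] for [i = k] and otherwise the condition that [h] imposes on batch
   [i]. *)
pose B i := if i == k then A
  else [set w | forall j : 'I_m, j.+1 = i -> Jk i w = h j].
have hB i : i \in k :: iota 1 m ->
    (if i is 0%N then events_of rho else events_of (Jk i)) (B i).
  rewrite inE /B; have [->//|ik] := eqVneq i k.
  rewrite mem_iota /= => /andP[i0 _]; case: i i0 ik => // i _ ik.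
  by exists [set S | forall j : 'I_m, j.+1 = i.+1 -> S = h j].
have ki : k \notin iota 1 m.
  rewrite mem_iota add1n ltnS negb_and -!ltnNge ltnS leqn0.
  exact: km.
have u : uniq (k :: iota 1 m) by rewrite /= ki iota_uniq.
have hE : history m @^-1` [set h] = \big[setI/setT]_(i <- iota 1 m) B i.
  have inI (s : seq nat) w : (\big[setI/setT]_(i <- s) B i) w <->
      (forall i, i \in s -> B i w).
    elim: s => [|i s IH]; first by rewrite big_nil.
    rewrite big_cons; split=> [[iw /IH hs] j|hs].
      by rewrite inE => /predU1P[->|/hs].
    by split; [apply: hs; rewrite mem_head|apply/IH => j js; apply: hs;
      rewrite inE js orbT].
  rewrite history_preimage; apply/seteqP; split=> w => [hw|/inI hw j _] /=.
    apply/inI => i im; rewrite /B; case: eqVneq => [ik|_].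
      by move: ki; rewrite -ik im.
    by move=> j ji; rewrite -ji; exact: hw.
  have jm : j.+1 \in iota 1 m by rewrite mem_iota add1n !ltnS /=.
  have := hw _ jm; rewrite /B; case: eqVneq => [jk|_]; last exact.
  by move: ki; rewrite -jk jm.
have Bk : B k = A by rewrite /B eqxx.
(* Independence is used twice: with [k] in the list, and on [iota 1 m] alone to reassemble the
   probability of the history. *)
have := hfresh u hB; rewrite !big_cons Bk => hP.
rewrite hE setIC hP muleC; congr (_ * _)%E.
apply/esym/(hfresh (iota_uniq 1 m)) => i im; apply: hB.
by rewrite inE im orbT.
Qed.

Lemma freezing_batch m (Phi : Omega -> {set 'I_n} -> R) :
    (forall S, determined (history m) (Phi^~ S)) ->
  \int[P]_w Phi w (Jk m.+1 w) = \int[P]_w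
    (\sum_(S : {set 'I_n} | #|S| == b) 'C(n, b)%:R^-1 * Phi w S).
Proof.
move=> hPhi; rewrite (freezing (Y := history m))//.
- apply: eq_Rintegral => w _; rewrite [RHS]big_mkcond /=; apply: eq_bigr => S _.
  by rewrite prob_batch; case: ifP => // _; rewrite mul0r.
- exact: measurable_history.
- exact: measurable_batch.
- move=> h S; apply: (@history_indep m.+1); first by rewrite ltnS leqnn orbT.
  by exists [set S].
Qed.

Lemma freezing_index m (Phi : Omega -> 'I_T.+2 -> R) :
    (forall r, determined (history m) (Phi^~ r)) ->
  \int[P]_w Phi w (index_ord w) = \int[P]_w
    (\sum_(r < T.+2 | (2 <= r)%N) T%:R^-1 * Phi w r).
Proof.
move=> hPhi; rewrite (freezing (Y := history m))//.
- apply: eq_Rintegral => w _; rewrite [RHS]big_mkcond /=; apply: eq_bigr => r _.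
  by rewrite prob_index; case: ifP => // _; rewrite mul0r.
- exact: measurable_history.
- exact: measurable_index.
- move=> h r; apply: (@history_indep 0) => //.
  by rewrite index_preimage; exists [set r : nat].
Qed.

End Sampling.

(** * Expectations along a run *)

(** Every preimage is a finite union of fibres of [Y]. The target is arbitrary so that this covers
    the extended-real distance. *)
Lemma determined_measurable (disp disp' : measure_display)
    (Omega : measurableType disp) (U : sigmaRingType disp') (S : finType)
    (Y : Omega -> S) (f : Omega -> U) :
    (forall s, measurable (Y @^-1` [set s])) -> determined Y f ->
  measurable_fun setT f.
Proof.
move=> mY hf _ A mA; rewrite setTI.
have -> : f @^-1` A = \bigcup_(s in Y @` (f @^-1` A)) (Y @^-1` [set s]).
  apply/seteqP; split=> w => [Aw|[_ [w' Aw' <-]] /= ww'].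
    by exists (Y w) => //; exists w.
  by rewrite /preimage/= (hf w w').
by apply: fin_bigcup_measurable => [|s _]; [exact: finite_finset|exact: mY].
Qed.

Section Run.
Context (R : realType) (X : normedModType R) (ip : {dot X for idfun})
  (n d : nat) (p : problem X n d) (LF delta tau nu alpha beta sigma : R).
Hypotheses (hX : finite_dimensional X) (hip : induces_norm ip)
  (hp : problem_regular p) (LF0 : 0 < LF) (hs : smooth ip p LF)
  (hu : unbiased_bounded_variance ip p sigma).
Hypotheses (delta0 : 0 < delta) (tau0 : 0 < tau)
  (nu01 : 0 < nu < 1) (al0 : 0 < alpha < (1 - nu) / 2) (be0 : 0 < beta < 1)
  (gap : K1 delta tau + K3 LF delta tau + 2 * LF <= K2 LF delta tau).
Local Notation eta := (eta_of LF delta tau nu alpha beta).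
Local Notation e := (eta / LF).
Context (disp : measure_display) (Omega : measurableType disp)
  (P : probability Omega R) (b T : nat) (rho : Omega -> nat)
  (Jk : nat -> Omega -> {set 'I_n}) (x1 : X) (B0 Lam0 : 'M[R]_(n, d))
  (x : nat -> Omega -> X) (B Lam : nat -> Omega -> 'M[R]_(n, d)).
Hypotheses (b0 : (0 < b)%N) (T0 : (0 < T)%N)
  (hJ : uniform_minibatches P (fun=> b) Jk)
  (hrho : uniform_index P T rho) (hfresh : fresh_samples P rho Jk)
  (hrun : DualHash_StoM ip p tau (fun=> e) (fun=> alpha) (fun=> beta)
            Jk x1 B0 Lam0 x B Lam).

Lemma run_subdifferential k w : subdifferential (hconj p) (Lam k.+1 w)
  (2 *: B k.+1 w - B k w - tau *: (Lam k.+1 w - Lam k w)).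
Proof. exact: (prox_subdifferential hp tau0 (run_Lam hrun k w)). Qed.

Lemma run_trajectory w : trajectory ip p tau e alpha
  (fun k => grad_x_batch ip p (lookahead beta (x^~ w) k) (B k w) (Jk k w))
  (x^~ w) (B^~ w) (Lam^~ w).
Proof.
split=> [k k0|k|k]; [exact: (run_x hrun w k0)|exact: (run_B hrun)|].
exact: run_subdifferential.
Qed.

(** The start is deterministic, the x- and B-steps are explicit, and the dual step is settled by
    [prox_unique]. Batch [k] first enters [x k.+1], hence the strict bound [i < k]. *)
Lemma run_adapted k w w' :
    (forall i, (0 < i < k)%N -> Jk i w = Jk i w') ->
  forall j, (j <= k)%N ->
    [/\ x j w = x j w', B j w = B j w' & Lam j w = Lam j w'].
Proof.
elim: k => [_ j|k IH hJk j].
  by rewrite leqn0 => /eqP ->;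
    rewrite !(run_x0 hrun) !(run_B0 hrun) !(run_Lam0 hrun).
have {}IH : forall i, (i <= k)%N ->
    [/\ x i w = x i w', B i w = B i w' & Lam i w = Lam i w'].
  by apply: IH => i /andP[i0 ik]; apply: hJk; rewrite i0 ltnW.
rewrite leq_eqVlt => /predU1P[->|]; last exact: IH.
have [xk Bk Lk] := IH k (leqnn k).
have xS : x k.+1 w = x k.+1 w'.
  case: k hJk IH xk Bk {Lk} => [|k] hJk IH xk Bk.
    by rewrite !(run_x1 hrun).
  rewrite !(run_x hrun _ (ltn0Sn k)) /=; have [xk' _ _] := IH k (leqnSn k).
  by rewrite xk xk' Bk hJk ?ltnSn.
have BS : B k.+1 w = B k.+1 w' by rewrite !(run_B hrun) xS Bk Lk.
split=> //; have := run_subdifferential k w; rewrite BS Bk Lk.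
by move=> /(prox_unique tau0); apply; exact: run_subdifferential.
Qed.

Lemma run_determined m k : (k <= m.+1)%N ->
  [/\ determined (history Jk m) (x k), determined (history Jk m) (B k)
    & determined (history Jk m) (Lam k)].
Proof.
move=> km; have h w w' : history Jk m w = history Jk m w' ->
    [/\ x k w = x k w', B k w = B k w' & Lam k w = Lam k w'].
  move=> /historyP hw; apply: (run_adapted _ km) => i im.
  by rewrite hw// -ltnS.
by split=> w w' /h[].
Qed.

Definition deviation k w i := grad_x_Fi ip p i (lookahead beta (x^~ w) k)
  (row i (B k w)) - grad_x_F ip p (lookahead beta (x^~ w) k) (B k w).

(** The batch [S] is an argument separate from the outcome, so that the past can be frozen while [S]
    is averaged. *)
Definition noise k w (S : {set 'I_n}) : X :=
  b%:R^-1 *: \sum_(i in S) deviation k w i.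

Lemma noiseE k w : grad_x_batch ip p (lookahead beta (x^~ w) k.+1) (B k.+1 w)
    (Jk k.+1 w) - grad_x_F ip p (lookahead beta (x^~ w) k.+1) (B k.+1 w)
  = noise k.+1 w (Jk k.+1 w).
Proof.
have [hb _] := hJ (ltn0Sn k).
have center (v : 'I_n -> X) g (S : {set 'I_n}) : #|S| = b ->
    (#|S|%:R : R)^-1 *: \sum_(j in S) v j - g
    = b%:R^-1 *: \sum_(j in S) (v j - g).
  move=> hS; rewrite sumrB scalerBr sumr_const hS -(scaler_nat b g) scalerA.
  by rewrite mulVf ?scale1r// pnatr_eq0 -lt0n.
exact: center.
Qed.

(** The 4 comes from [dist0_le]; the rest is the scaled term [e] times the squared noise hidden in
    the inner product of noise and x-increment. *)
Definition weight := 4 + 2 * dist_const LF delta tau nu alpha beta / LF * e.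

Definition noise_term k w (S : {set 'I_n}) :=
  weight * ip (noise k.+1 w S) (noise k.+1 w S)
  - 2 * dist_const LF delta tau nu alpha beta / LF
    * ip (noise k.+1 w S)
         (drift ip p LF delta tau nu alpha beta (x^~ w) (B^~ w) k).

Definition dist_bound k w := 4 * ip (noise k.+1 w (Jk k.+1 w))
    (noise k.+1 w (Jk k.+1 w))
  + dist_const LF delta tau nu alpha beta * progress ip (x^~ w) (B^~ w) k.+1.

Lemma noise_term_determined k S :
  determined (history Jk k) ((noise_term k)^~ S).
Proof.
move=> w w' hw; have [h1 h2 _] := run_determined (leqnn k.+1).
have [h3 _ _] := run_determined (leqnSn k).
rewrite /noise_term /noise /deviation /drift /lookahead /=.
by rewrite (h1 _ _ hw) (h2 _ _ hw) (h3 _ _ hw).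
Qed.

Lemma dist_const_ge2 : 2 <= dist_const LF delta tau nu alpha beta.
Proof.
rewrite /dist_const addrAC lerDr.
by do ?[exact: ler0n | exact: sqr_ge0 | apply: addr_ge0 | apply: mulr_ge0].
Qed.

Lemma weight_gt0 : 0 < weight.
Proof.
have := step_gt0 LF0 delta0 tau0 nu01 al0 be0.
rewrite /weight => e0; rewrite ltr_pwDl// mulr_ge0 ?(ltW e0)//.
rewrite divr_ge0 ?(ltW LF0)// mulr_ge0//.
exact: le_trans dist_const_ge2.
Qed.

Lemma noise_term_expectation k :
  \int[P]_w noise_term k w (Jk k.+1 w) <= weight * (sigma ^+ 2 / b%:R).
Proof.
rewrite (freezing_batch hJ hfresh (@noise_term_determined k)).
have <- : \int[P]_w (weight * (sigma ^+ 2 / b%:R))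
    = weight * (sigma ^+ 2 / b%:R).
  by rewrite Rintegral_cst// [X in fine X](probability_setT P) mulr1.
have mH := @measurable_history _ _ _ _ _ _ _ hJ k.
apply: le_Rintegral => //.
- apply: (determined_integrable P mH); apply: determined_sum => S _ w w' hw.
  by rewrite (@noise_term_determined k S w w' hw).
- exact: finite_measure_integrable_cst.
(* A batch of [b] distinct indices exists, namely the one drawn at [w]. *)
move=> w _; have bn : (b <= n)%N.
  have [hb _] := hJ (ltn0Sn 0).
  by rewrite -(hb w) -[leqRHS]card_ord max_card.
have [h1 h2] := hu (lookahead beta (x^~ w) k.+1) (B k.+1 w).
have n0 : n%:R != 0 :> R by rewrite pnatr_eq0 -lt0n (leq_trans b0).
have center (v : 'I_n -> X) g :
    n%:R^-1 *: \sum_i v i = g -> \sum_i (v i - g) = 0.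
  move=> <-; rewrite sumrB sumr_const card_ord -[_ *+ n]scaler_nat scalerA.
  by rewrite divff// scale1r subrr.
have v0 : \sum_i deviation k.+1 w i = 0 := center _ _ h1.
have vs : n%:R^-1 * \sum_i ip (deviation k.+1 w i) (deviation k.+1 w i)
    <= sigma ^+ 2.
  by move: h2; under eq_bigr do rewrite -hip.
exact: (batch_moments (dot_for_inner ip) b0 bn v0 vs _ _ (ltW weight_gt0)).
Qed.

Lemma dist_bound_determined k m :
  (k < m)%N -> determined (history Jk m) (dist_bound k).
Proof.
move=> km w w' hw; have [h1 h2 _] := run_determined (leqW (ltnW km)).
have km1 : (k.+1 <= m.+1)%N by apply: ltnW.
have [h3 h4 _] := run_determined km1.
have [h5 h6 _] := run_determined (km : (k.+2 <= m.+1)%N).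
have hJk : Jk k.+1 w = Jk k.+1 w' by apply: (historyP hw).
rewrite /dist_bound /noise /deviation /progress /lookahead /= hJk.
by rewrite (h1 _ _ hw) (h2 _ _ hw) (h3 _ _ hw) (h4 _ _ hw) (h5 _ _ hw)
  (h6 _ _ hw).
Qed.

Lemma dist_bound_ge0 k w : 0 <= dist_bound k w.
Proof.
rewrite addr_ge0// mulr_ge0//.
- exact: (dot_ge0 (dot_for_inner ip)).
- by apply: le_trans dist_const_ge2.
by rewrite /progress !addr_ge0// ?(dot_ge0 (dot_for_inner ip))//;
  exact: (dot_ge0 (frob_inner R n d)).
Qed.

Local Notation Lyap k w :=
  (lyapunov ip p LF delta tau nu alpha beta (x^~ w) (B^~ w) (Lam^~ w) k).

Lemma lyapunov_determined k m : (k < m)%N ->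
  determined (history Jk m) (fun w => Lyap k.+1 w).
Proof.
move=> km w w' hw; have [h1 h2 _] := run_determined (leqW (ltnW km)).
have km1 : (k.+1 <= m.+1)%N by apply: ltnW.
have [h3 h4 h7] := run_determined km1.
have [h5 h6 _] := run_determined (km : (k.+2 <= m.+1)%N).
rewrite /lyapunov /=.
by rewrite (h1 _ _ hw) (h2 _ _ hw) (h3 _ _ hw) (h4 _ _ hw) (h5 _ _ hw)
  (h6 _ _ hw) (h7 _ _ hw).
Qed.

(** Expectation of [sum_dist_bound]: the final Lyapunov value is replaced by its almost sure lower
    bound, and each noise term by its variance bound. *)
Lemma expected_sum_dist (N : nat) (Psi_star : R) :
    {ae P, forall w, Psi_star <= Lyap N.+1 w} ->
  \int[P]_w (\sum_(k < N) dist_bound k w)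
  <= 2 * dist_const LF delta tau nu alpha beta / LF
       * (\int[P]_w Lyap 1 w - Psi_star)
     + N%:R * (weight * (sigma ^+ 2 / b%:R)).
Proof.
move=> hPsi; set q := 2 * _ / LF.
have q0 : 0 <= q.
  rewrite divr_ge0 ?(ltW LF0)// mulr_ge0//; exact: le_trans dist_const_ge2.
have mH := @measurable_history _ _ _ _ _ _ _ hJ N.+1.
have dNoise k : (k <= N)%N ->
    determined (history Jk N.+1) (fun w => noise_term k w (Jk k.+1 w)).
  move=> kN w w' hw; have hJk := historyP hw.
  have -> : Jk k.+1 w = Jk k.+1 w' by exact: hJk.
  apply: (@noise_term_determined k _ w w'); apply/ffunP => i.
  rewrite !ffunE; apply: hJk; rewrite /= ltnS.
  exact: leq_trans (ltnW (ltn_ord i)) kN.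
have dL k : (k <= N)%N -> determined (history Jk N.+1) (fun w => Lyap k.+1 w).
  by move=> kN; exact: lyapunov_determined.
have iL k : (k <= N)%N -> P.-integrable setT (EFin \o (fun w => Lyap k.+1 w)).
  by move=> kN; apply: (determined_integrable P mH); exact: dL.
have dS : determined (history Jk N.+1)
    (fun w => \sum_(k < N) noise_term k w (Jk k.+1 w)).
  by apply: determined_sum => k _; apply: dNoise; exact: ltnW.
have iB : P.-integrable setT (EFin \o (fun w => Lyap 1 w - Lyap N.+1 w)).
  apply: (determined_integrable P mH) => w w' hw.
  by rewrite (dL 0 _ _ _ hw)// (dL N _ _ _ hw).
have iqB : P.-integrable setT (EFin \o (fun w => q * (Lyap 1 w - Lyap N.+1 w))).
  apply: (determined_integrable P mH) => w w' hw.
  by rewrite (dL 0 _ _ _ hw)// (dL N _ _ _ hw).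
have iS := determined_integrable P mH dS.
apply: (@le_trans _ _ (\int[P]_w (q * (Lyap 1 w - Lyap N.+1 w)
    + \sum_(k < N) noise_term k w (Jk k.+1 w)))).
  apply: le_Rintegral => //.
  - apply: (determined_integrable P mH); apply: determined_sum => k _.
    by apply: dist_bound_determined; rewrite ltnS ltnW.
  - apply: (determined_integrable P mH) => w w' hw.
    congr (q * (_ - _) + _); last exact: (dS _ _ hw).
      exact: (dL 0 _ _ _ hw).
    exact: (dL N (leqnn N) _ _ hw).
  move=> w _; have := sum_dist_bound hX hip hp LF0 hs delta0 tau0 nu01 al0 be0
    gap (run_trajectory w) N.
  by under eq_bigr do rewrite noiseE;
    under [X in _ + X]eq_bigr do rewrite noiseE.
rewrite RintegralD//; apply: lerD.
  rewrite RintegralZl// ler_wpM2l// RintegralB//; try exact: iL.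
  by rewrite lerB//; apply: (ae_Rintegral_ge mH); [exact: dL|exact: hPsi].
rewrite (Rintegral_sum P mH); last by move=> k; apply: dNoise; exact: ltnW.
rewrite mulr_natl -[N in X in _ <= X]card_ord -sumr_const.
by apply: ler_sum => k _; exact: noise_term_expectation.
Qed.

Local Notation sqdist w := (dist0 (lagrangian_subdiff ip p (x (rho w) w)
  (B (rho w) w) (Lam (rho w) w)) ^+ 2)%E.

Lemma sqdist_le w : (sqdist w <= (dist_bound (rho w).-1 w)%:E)%E.
Proof.
have /andP[r2 _] := hrho.1 w.
have := dist0_le hip LF0 hs delta0 tau0 nu01 al0 be0 (run_trajectory w)
  (rho w).-1.
have rE : rho w = (rho w).-1.+1 by rewrite prednK// (leq_trans _ r2).
rewrite noiseE.
by rewrite [in X in _ -> (X <= _)%E]rE.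
Qed.

(** As [rho] is independent of the batches, averaging over it gives [T^-1] times the sum of the
    bounds at iterates 2 to [T + 1]. *)
Lemma expected_sqdist :
  (\int[P]_w sqdist w
   <= (T%:R^-1 * \int[P]_w (\sum_(k < T.+1) dist_bound k w))%:E)%E.
Proof.
(* The distance at the random index depends on [rho] and on the history together. *)
pose Y w := (index_ord T rho w, history Jk T.+1 w).
have mH := @measurable_history _ _ _ _ _ _ _ hJ T.+1.
have mY u : measurable (Y @^-1` [set u]).
  case: u => r h.
  have -> : Y @^-1` [set (r, h)]
      = index_ord T rho @^-1` [set r] `&` history Jk T.+1 @^-1` [set h].
    apply/seteqP; split=> w; first by case=> <- <-.
    by move=> [Yr Yh]; rewrite /preimage/= /Y Yr Yh.
  by apply: measurableI; [exact: (measurable_index hrho)|exact: mH].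
have rhoT w : (rho w < T.+2)%N by have /andP[] := hrho.1 w.
have Yrho w w' : Y w = Y w' -> rho w = rho w'.
  by move=> [/(congr1 (@nat_of_ord _))]; rewrite !inordK.
have dsq : determined Y (fun w => sqdist w).
  move=> w w' ww'; have [_ hw] := ww'; rewrite (Yrho _ _ ww').
  have [h1 h2 h3] := run_determined (ltnW (rhoT w')).
  by rewrite (h1 _ _ hw) (h2 _ _ hw) (h3 _ _ hw).
have dbd : determined Y (fun w => dist_bound (rho w).-1 w).
  move=> w w' ww'; have [_ hw] := ww'; rewrite (Yrho _ _ ww').
  apply: dist_bound_determined hw.
  by have := rhoT w'; case: (rho w').
have ibd := determined_integrable P mY dbd.
have dD k : (k <= T)%N -> determined (history Jk T.+1) (dist_bound k).
  by move=> kT; exact: dist_bound_determined.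
have dSum : determined (history Jk T.+1)
    (fun w => \sum_(k < T.+1) dist_bound k w).
  by apply: determined_sum => k _; apply: dD; rewrite -ltnS ltn_ord.
have dPhi (r : 'I_T.+2) :
    determined (history Jk T.+1) (fun w => dist_bound r.-1 w).
  by apply: dD; have := ltn_ord r; case: (nat_of_ord r).
apply: (@le_trans _ _ (\int[P]_w (dist_bound (rho w).-1 w)%:E)%E).
  apply: ge0_le_integral => //.
  - by move=> w _; rewrite expe2 mule_ge0//;
      apply: le_ereal_inf_tmp => _ [u _ <-]; rewrite lee_fin sqrtr_ge0.
  - by apply: (determined_measurable mY) => w w'; exact: dsq.
  - by case/integrableP: ibd.
  - by move=> w _; exact: sqdist_le.
rewrite -(fineK (integrable_fin_num _ ibd))// lee_fin -/(Rintegral P setT _).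
have -> : \int[P]_w dist_bound (rho w).-1 w = \int[P]_w
    (fun w (r : 'I_T.+2) => dist_bound r.-1 w) w (index_ord T rho w).
  by apply: eq_Rintegral => w _; rewrite inordK.
rewrite (freezing_index hJ hrho hfresh dPhi).
rewrite -RintegralZl//; last exact: (determined_integrable P mH dSum).
apply: le_Rintegral => //.
- apply: (determined_integrable P mH); apply: determined_sum => r _ w w' hw.
  by rewrite (dPhi r _ _ hw).
- apply: (determined_integrable P mH) => w w' hw.
  by congr (_ * _); exact: (dSum _ _ hw).
(* Iterate [r] corresponds to [dist_bound r.-1]: the term [r = 0] is zero and splits off, and the
   excluded [r = 1] is compared with the nonnegative [dist_bound 0]. *)
move=> w _; rewrite mulr_sumr big_mkcond big_ord_recl/= add0r.
have Ti : 0 <= T%:R^-1 :> R by rewrite invr_ge0.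
apply: ler_sum => k _; case: ifP => _ //.
by rewrite mulr_ge0// dist_bound_ge0.
Qed.

End Run.

(** * The convergence rate *)

(** There are [t + 1] noise terms but the division is by [t]; [(t + 1) / t <= 2] explains the factor
    2 before [w]. *)
Lemma rate_arith (R : realFieldType) (t c q D w s2 eps2 : R) :
    1 <= t -> 0 < c -> 0 <= w -> 0 <= s2 ->
    q * D + 2 * w * (s2 / c) <= t * eps2 ->
  t^-1 * (q * D + (t + 1) * (w * (s2 / (c * t)))) <= eps2.
Proof.
move=> t1 c0 w0 s20 h; have t0 : 0 < t by exact: lt_le_trans ltr01 t1.
rewrite ler_pdivrMl//; apply: le_trans h; rewrite lerD2l.
have -> : (t + 1) * (w * (s2 / (c * t))) = (w * (s2 / c)) * ((t + 1) / t).
  by field; rewrite !gt_eqF.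
have -> : 2 * w * (s2 / c) = (w * (s2 / c)) * 2 by ring.
apply: ler_wpM2l; first by rewrite mulr_ge0// divr_ge0// ltW.
by rewrite ler_pdivrMr//; lra.
Qed.

(** Multiplying the ceiling bound by [eps ^+ 2 < 1] gives [t * eps ^+ 2 <= |A0| + 1]; the number of
    calls is quadratic in [t]. *)
Lemma sfo_arith (R : realFieldType) (t c A A0 eps : R) :
    0 < c -> 0 < eps -> eps < 1 -> 0 <= t -> A <= A0 ->
    t - 1 < A / eps ^+ 2 ->
  t * (c * t) <= c * (`|A0| + 1) ^+ 2 * eps ^- 4.
Proof.
move=> c0 e0 e1 t0 AA0 h.
have e20 : 0 < eps ^+ 2 by rewrite exprn_gt0.
have e21 : eps ^+ 2 <= 1 by rewrite exprn_ile1// ltW.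
have te : t * eps ^+ 2 <= `|A0| + 1.
  move: h; rewrite ltr_pdivlMr// mulrBl mul1r => h.
  have := ler_norm A0; lra.
have te0 : 0 <= t * eps ^+ 2 by rewrite mulr_ge0// ltW.
rewrite ler_pdivlMr ?exprn_gt0//.
have -> : t * (c * t) * eps ^+ 4 = c * (t * eps ^+ 2) ^+ 2 by ring.
by rewrite ler_pM2l// lerXn2r// nnegrE (le_trans te0).
Qed.

Theorem theorem1 (R : realType) :
  exists delta c_delta : R, 0 < delta /\ 0 < c_delta /\
  forall LF nu alpha beta tau : R,
    0 < LF ->
    0 < nu < 1 ->
    0 < alpha < (1 - nu) / 2 ->
    0 < beta < 1 ->
    0 < tau <= Num.sqrt (c_delta * delta ^+ 2) / LF ->
  let eta := eta_of LF delta tau nu alpha beta in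
  exists L_Delta C_sigma : R, 0 < L_Delta /\ 0 < C_sigma /\
  forall sigma c_b Delta_max : R, 0 < c_b ->
  exists C_sfo eps0 : R, 0 < C_sfo /\ 0 < eps0 /\
  forall (X : normedModType R) (ip : {dot X for idfun}) (n d : nat)
    (p : problem X n d),
    finite_dimensional X ->
    induces_norm ip ->
    (0 < n)%N ->
    problem_regular p ->
    (exists J_star : R, forall x B, (J_star%:E <= J p x B)%E) ->
    smooth ip p LF ->
    unbiased_bounded_variance ip p sigma ->
  forall (eps : R) (T b : nat),
    0 < eps ->
    (0 < T)%N ->
    b%:R = c_b * T%:R ->
  forall (disp : measure_display) (Omega : measurableType disp)
    (P : probability Omega R)
    (rho : Omega -> nat) (Jk : nat -> Omega -> {set 'I_n})
    (x1 : X) (B0 Lam0 : 'M[R]_(n, d))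
    (x : nat -> Omega -> X) (B Lam : nat -> Omega -> 'M[R]_(n, d)),
    uniform_minibatches P (fun=> b) Jk ->
    uniform_index P T rho ->
    fresh_samples P rho Jk ->
    DualHash_StoM ip p tau (fun=> eta / LF) (fun=> alpha) (fun=> beta)
      Jk x1 B0 Lam0 x B Lam ->
    {ae P, forall w,
      bounded_iterates (x ^~ w) (B ^~ w) (Lam ^~ w)} ->
  let Psi k w := Psi_sgdm p LF delta tau nu alpha beta
                   (x ^~ w) (B ^~ w) (Lam ^~ w) k in
  forall Psi_star Delta1 : R,
    {ae P, forall w, forall k, (1 <= k)%N -> (Psi_star%:E <= Psi k w)%E} ->
    Delta1%:E = ((\int[P]_w Psi 1%N w) - Psi_star%:E)%E ->
    T%:Z = Num.ceil ((L_Delta * Delta1 + C_sigma * (sigma ^+ 2 / c_b))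
                     / eps ^+ 2) ->
    (\int[P]_w
        (dist0 (lagrangian_subdiff ip p (x (rho w) w) (B (rho w) w)
                  (Lam (rho w) w)) ^+ 2) <= (eps ^+ 2)%:E)%E
    /\
    (Delta1 <= Delta_max -> eps < eps0 ->
       forall w, (sfo_calls Jk T w)%:R <= C_sfo * eps ^- 4).
Proof.
pose delta : R := 12^-1; have delta0 : 0 < delta by rewrite invr_gt0.
exists delta, 1; split=> //; split=> //.
move=> LF nu alpha beta tau LF0 nu01 al0 be0 /andP[tau0 tauS] eta.
(* With [c_delta = 1] the square root in the step bound is [delta] itself, which gives the
   hypothesis of [K_gap]. *)
have tauLF : tau * LF <= delta.
  move: tauS; rewrite mul1r sqrtr_sqr ger0_norm ?(ltW delta0)//.
  by rewrite ler_pdivlMr.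
have gap := K_gap LF0 delta0 tau0 erefl tauLF.
pose q := 2 * dist_const LF delta tau nu alpha beta / LF.
pose wt := weight LF delta tau nu alpha beta.
have wt0 : 0 < wt by exact: weight_gt0.
have q0 : 0 < q.
  rewrite divr_gt0// mulr_gt0//.
  exact: lt_le_trans (dist_const_ge2 _ _ _ _ _ _).
(* [L_Delta] is the Lyapunov factor of [sum_dist_bound], and [C_sigma] twice the noise weight, the 2
   coming from [rate_arith]. *)
exists q, (2 * wt); split=> //; split; first by rewrite mulr_gt0.
move=> sigma c_b Delta_max cb0.
(* Bounds the numerator of [T] over all problems with [Delta1 <= Delta_max], so that the constant
   for the oracle calls is chosen before the problem. *)
pose A0 := q * Delta_max + 2 * wt * (sigma ^+ 2 / c_b).
have A01 : 0 < `|A0| + 1 by rewrite ltr_wpDl.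
exists (c_b * (`|A0| + 1) ^+ 2), 1; split.
  by rewrite mulr_gt0// exprn_gt0.
split=> // X ip n d p hX hip n0 hp _ hs hu eps T b eps0 T0 bE.
move=> disp Omega P rho Jk x1 B0 Lam0 x B Lam hJ hrho hfresh hrun _ Psi.
move=> Psi_star Delta1 hPsi hDelta hT; rewrite /eta in hrun.
have b0 : (0 < b)%N by rewrite -(ltr_nat R) bE mulr_gt0// ltr0n.
have T1 : 1 <= T%:R :> R by rewrite ler1n.
have hceil := ceil_itv ((q * Delta1 + 2 * wt * (sigma ^+ 2 / c_b)) / eps ^+ 2).
rewrite -hT rmorphB /= -pmulrn in hceil.
have /andP[hT1 hT2] := hceil.
have PsiE k w : Psi k.+1 w = (lyapunov ip p LF delta tau nu alpha beta
    (x^~ w) (B^~ w) (Lam^~ w) k.+1)%:E.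
  exact: (Psi_sgdmE hip (run_trajectory hp tau0 hrun w)).
(* [Psi 1] is real-valued and depends on the first batch only, hence is integrable, so the
   extended-real identity for [Delta1] descends to the reals. *)
have DeltaE : \int[P]_w lyapunov ip p LF delta tau nu alpha beta
    (x^~ w) (B^~ w) (Lam^~ w) 1 - Psi_star = Delta1.
  have iL := determined_integrable P (@measurable_history _ _ _ _ _ _ _ hJ 1)
    (lyapunov_determined hp tau0 hrun (ltn0Sn 0)).
  apply: EFin_inj; rewrite hDelta EFinB fineK ?integrable_fin_num//.
  by congr (_ - _)%E; apply: eq_integral => w _; rewrite PsiE.
split.
  apply: le_trans (expected_sqdist hip hp LF0 hs delta0 tau0 nu01 al0 be0 b0 hJ
    hrho hfresh hrun) _.
  rewrite lee_fin; apply: le_trans (rate_arith T1 cb0 (ltW wt0)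
    (sqr_ge0 sigma) _); last first.
    by move: hT2; rewrite ler_pdivrMr ?exprn_gt0//; exact.
  rewrite -bE natr1 -DeltaE; apply: ler_wpM2l; first by rewrite invr_ge0 ler0n.
  have := @expected_sum_dist _ _ _ _ _ _ _ _ _ _ _ _ _ hX hip hp LF0 hs hu
    delta0 tau0 nu01 al0 be0 gap _ _ _ _ _ _ _ _ _ _ _ _ b0 hJ hfresh hrun
    T.+1 Psi_star.
  apply; apply: filterS hPsi => w hw.
  (* With [T + 1] summands the telescoping ends at index [T + 2]. *)
  by have := hw T.+2 isT; rewrite PsiE lee_fin.
move=> hDmax eps1 w.
have -> : (sfo_calls Jk T w)%:R = T%:R * (c_b * T%:R).
  rewrite -bE -natrM /sfo_calls (eq_big_nat _ _ (F2 := fun=> b)).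
    by rewrite sum_nat_const_nat subn1.
  by move=> k /andP[k1 _]; case: k k1 => // k _; have [-> _] := hJ _ (ltn0Sn k).
have D0 : q * Delta1 + 2 * wt * (sigma ^+ 2 / c_b) <= A0.
  by rewrite lerD2r ler_pM2l.
by apply: sfo_arith cb0 eps0 eps1 _ D0 _ => //; rewrite ler0n.
Qed.
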